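(* Let $k\ge 3$ and $n>2k$ be integers, let $X$ be a set with $|X|=n$, and let $\mathcal{H}\subseteq\binom{X}{k}$ be an intersecting family. Assume that $\mathcal{H}\nsubseteq_S \mathcal{F}_0$, that $\mathcal{H}\nsubseteq_S \mathcal{F}_1$, and, if $k=3$, that $\mathcal{H}\nsubseteq_S \mathcal{G}_2$. Then \[ |\mathcal{H}|\le \binom{n-1}{k-1}-\binom{n-k-1}{k-1}-\binom{n-k-2}{k-2}+2 . \] Moreover, for $k=4$ equality holds if and only if $\mathcal{H}$ is isomorphic to $\mathcal{J}_2$, $\mathcal{G}_2$ or $\mathcal{G}_3$; for every other $k\ge 3$, equality holds if and only if $\mathcal{H}$ is isomorphic to $\mathcal{J}_2$.
   Context: A family $\mathcal{F}$ of sets is intersecting if $F_1\cap F_2\neq\emptyset$ for all $F_1,F_2\in\mathcal{F}$; $\binom{X}{k}$ denotes the set of all $k$-element subsets of $X$. For families $\mathcal{H}\subseteq 2^X$, $\mathcal{G}\subseteq 2^Y$, write $\mathcal{H}\subseteq_S\mathcal{G}$ if there is an injective map $f:X\to Y$ with $f(E)\in\mathcal{G}$ for all $E\in\mathcal{H}$; $\mathcal{H}$ and $\mathcal{G}$ are isomorphic if $\mathcal{H}\subseteq_S\mathcal{G}$ and $\mathcal{G}\subseteq_S\mathcal{H}$. All families below are $k$-uniform families on $X$. $\mathcal{F}_0$: any family isomorphic to $\{F\in\binom{X}{k}: x\in F\}$ for some $x\in X$. $\mathcal{F}_1$: any family isomorphic to $\{F\}\cup\{G\in\binom{X}{k}: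 x\in G,\ G\cap F\neq\emptyset\}$ for some $k$-set $F\subseteq X$ and $x\in X\setminus F$. $\mathcal{G}_i$ ($2\le i\le k$): any family isomorphic to $\mathcal{G}(E,x_0)=\{G\in\binom{X}{k}: E\subseteq G\}\cup\{G\in\binom{X}{k}: x_0\in G,\ G\cap E\neq\emptyset\}$, where $E\subseteq X$ is an $i$-set and $x_0\in X\setminus E$. (So $\mathcal{G}_2$ is isomorphic to $\{F\in\binom{X}{k}:|F\cap S|\ge 2\}$ for a 3-set $S$.) $\mathcal{J}_i$ ($1\le i\le k-1$): any family isomorphic to $\mathcal{J}(E,J,x_0)=\{G\in\binom{X}{k}: E\subseteq G,\ G\cap J\neq\emptyset\}\cup\{G\in\binom{X}{k}: J\subseteq G\}\cup\{G\in\binom{X}{k}: x_0\in G,\ G\cap E\neq\emptyset\}$, where $E\subseteq X$ is a $(k-1)$-set, $J\subseteq X\setminus E$ is an $(i+1)$-set and $x_0\in J$. *)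

(* Defs.v *)
From mathcomp Require Import all_boot.
Set Implicit Arguments. Unset Strict Implicit. Unset Printing Implicit Defensive.

Section Fam.
Variable X : finType.
Implicit Types (H G : {set {set X}}) (E F J : {set X}) (x : X).

Definition uniform (k : nat) H := forall F, F \in H -> #|F| = k.

Definition intersecting H :=
  forall F1 F2, F1 \in H -> F2 \in H -> F1 :&: F2 != set0.

Definition subS H G :=
  exists f : X -> X, injective f /\ forall E, E \in H -> f @: E \in G.

Definition isomorphic H G := subS H G /\ subS G H.

Definition star (k : nat) x : {set {set X}} :=
  [set F : {set X} | (#|F| == k) && (x \in F)].

Definition F1fam (k : nat) F x : {set {set X}} :=
  F |: [set G : {set X} | [&& #|G| == k, x \in G & G :&: F != set0]].

Definition Gfam (k : nat) E x0 : {set {set X}} :=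
  [set G : {set X} | (#|G| == k) &&
     ((E \subset G) || ((x0 \in G) && (G :&: E != set0)))].

Definition Jfam (k : nat) E J x0 : {set {set X}} :=
  [set G : {set X} | (#|G| == k) &&
     [|| (E \subset G) && (G :&: J != set0),
         J \subset G
       | (x0 \in G) && (G :&: E != set0)]].

Definition subS_F0 (k : nat) H := exists x, subS H (star k x).

Definition subS_F1 (k : nat) H :=
  exists F x, #|F| = k /\ x \notin F /\ subS H (F1fam k F x).

Definition subS_G (k i : nat) H :=
  exists E x0, #|E| = i /\ x0 \notin E /\ subS H (Gfam k E x0).

Definition iso_G (k i : nat) H :=
  exists E x0, #|E| = i /\ x0 \notin E /\ isomorphic H (Gfam k E x0).

Definition iso_J (k i : nat) H :=
  exists E J x0, [/\ #|E| = k.-1, #|J| = i.+1, [disjoint J & E], x0 \in J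
                   & isomorphic H (Jfam k E J x0)].

End Fam.

(* Main.v *)
Require Import Defs.
From mathcomp Require Import all_boot perm zify.
Set Implicit Arguments. Unset Strict Implicit. Unset Printing Implicit Defensive.

(** Call a pair {x, y} a cover of [H] if it meets every member of [H].

    If {x, y} is a cover, the members through exactly one of x, y form two
    cross-intersecting (k-1)-uniform families on the other n-2 points, each with at
    least two members.  For such pairs of families the sharp bound follows by shifting
    and then deleting the last point of the ground set; its equality cases give
    [J_2], [G_2] and [G_3].  If exactly one member misses {x, y}, the Hilton-Milner
    bound for cross-intersecting pairs gives the same estimate, strictly unless [H]
    has a cover.

    If every pair is missed by at least two members, the inequality is strict.  A
    shift of y to x either keeps this property or creates a cover {x, q}, and then the
    equality structure of the shifted family forces the original one below the bound.
    A fully shifted family without a cover is handled by deleting the last point,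
    where the Hilton-Milner bound controls the link. *)

(** In a fully shifted family the largest point [v] is replaceable: a member through [v] may trade
    it for any point outside. Deleting [v] therefore keeps the side conditions (two members, no
    cover), and the link at [v] still intersects. Each bound thus becomes an induction or a single
    step on the ground set, matched with Pascal's rule. Inductions start at ground sets of twice the
    rank, where pairing sets with complements gives the bound. The obstacle is that shifting may
    create a cover. A bound for the shifted family alone is then not strict enough, so its equality
    cases have to be pulled back. Rank 2 is exceptional for cross-intersecting pairs: two full stars
    with a common centre exceed the bound on more than four points. For k = 3 the two sides of a
    cover are such graphs, and the stars yield [G_2]; hence the extra hypothesis. In rank 3 two such
    stars meet the bound exactly, which is the origin of the additional extremal families at k =
    4. *)

Section Basic.
Variable X : finType.
Implicit Types (A B D H : {set {set X}}) (F G P Q R V W e : {set X}) (l k m n : nat).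

(** * Uniform families, deletions and links, and counting the sets that meet given sets *)

Definition ksub V l : {set {set X}} := [set F : {set X} | (F \subset V) && (#|F| == l)].

Lemma ksubP V l F : reflect (F \subset V /\ #|F| = l) (F \in ksub V l).
Proof. by rewrite inE; apply: (iffP andP) => -[? /eqP]. Qed.

Lemma card_ksub V l : #|ksub V l| = 'C(#|V|, l).
Proof. by rewrite -cards_draws; apply: eq_card => F; rewrite !inE. Qed.

Definition del A v : {set {set X}} := [set F in A | v \notin F].
Definition link A v : {set {set X}} := [set R : {set X} | (v \notin R) && (v |: R \in A)].

Lemma delP A v F : reflect (F \in A /\ v \notin F) (F \in del A v).
Proof. by rewrite inE; apply: andP. Qed.

Lemma linkP A v F : reflect (v \notin F /\ v |: F \in A) (F \in link A v).
Proof. by rewrite inE; apply: andP. Qed.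

(** The family counterpart of Pascal's rule: inductions on the ground set split the family here and
    the binomials by [binS] or [bin_pred]. *)
Lemma card_del_link A v : #|A| = #|del A v| + #|link A v|.
Proof.
rewrite -(cardsID [set F : {set X} | v \notin F] A); congr (_ + _).
  by apply: eq_card => F; rewrite !inE.
rewrite -(@card_in_imset _ _ (fun R => v |: R) (link A v)); last first.
  by move=> R S /linkP[vR _] /linkP[vS _] /(congr1 (fun F => F :\ v)); rewrite !setU1K.
apply: eq_card => F; apply/setDP/imsetP => [[FA]|[R /linkP[vR RA] ->]].
  rewrite inE negbK => vF; exists (F :\ v); last by rewrite setD1K.
  by apply/linkP; rewrite setD1K // !inE eqxx.
by split=> //; rewrite !inE eqxx.
Qed.

Lemma del_sub V l A v : A \subset ksub V l -> del A v \subset ksub (V :\ v) l.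
Proof.
move/subsetP=> AV; apply/subsetP=> F /delP[/AV/ksubP[FV lF] vF].
by apply/ksubP; split=> //; rewrite subsetD1 FV.
Qed.

Lemma link_sub V l A v : A \subset ksub V l.+1 -> link A v \subset ksub (V :\ v) l.
Proof.
move/subsetP=> AV; apply/subsetP=> F /linkP[vF /AV/ksubP[FV lF]].
move: FV lF; rewrite subUset => /andP[_ FV]; rewrite cardsU1 vF => -[lF].
by apply/ksubP; split=> //; rewrite subsetD1 FV.
Qed.

Definition cross A B := forall F G, F \in A -> G \in B -> F :&: G != set0.

Lemma crossC A B : cross A B -> cross B A.
Proof. by move=> AB F G FB GA; rewrite setIC; apply: AB. Qed.

Lemma cross_sub A B A' B' : A' \subset A -> B' \subset B -> cross A B -> cross A' B'.
Proof. by move=> /subsetP sA /subsetP sB AB F G /sA FA /sB; apply: AB. Qed.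

Lemma sub_del A v : del A v \subset A.
Proof. by apply/subsetP=> F /delP[]. Qed.

Lemma cross_disj A B F G : cross A B -> F \in A -> G \in B -> [disjoint F & G] -> False.
Proof. by move=> AB FA GB; rewrite -setI_eq0 (negPf (AB _ _ FA GB)). Qed.

Lemma cross_mem A B F G : cross A B -> F \in A -> G \in B -> exists2 z, z \in F & z \in G.
Proof. by move=> AB FA GB; have /set0Pn[z /setIP[]] := AB _ _ FA GB; exists z. Qed.

Lemma cardsU_disj (T : finType) (A B : {set T}) :
  [disjoint A & B] -> #|A :|: B| = #|A| + #|B|.
Proof. by move=> dAB; apply/eqP; rewrite (leq_card_setU A B).2. Qed.

Definition hits D P := forall Q, Q \in D -> Q :&: P != set0.

Lemma hits_disj D W q P : hits D P -> [disjoint D & ksub (W :\: P) q].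
Proof.
move=> hD; apply/pred0P => Q /=; apply/negbTE/negP => /andP[/hD hQ /ksubP[]].
by rewrite subsetD => /andP[_]; rewrite -setI_eq0 (negPf hQ).
Qed.

Lemma ksubS V W l : V \subset W -> ksub V l \subset ksub W l.
Proof.
by move=> VW; apply/subsetP=> F /ksubP[FV lF]; apply/ksubP; rewrite (subset_trans FV VW).
Qed.

Lemma card_hits D W q P : D \subset ksub W q -> hits D P ->
  #|D| + 'C(#|W :\: P|, q) <= 'C(#|W|, q).
Proof.
move=> DW hD; rewrite -!card_ksub.
rewrite -cardsU_disj ?hits_disj //.
by apply: subset_leq_card; rewrite subUset DW ksubS ?subsetDl.
Qed.

Lemma card_hits_ge D W q P : ksub W q \subset D :|: ksub (W :\: P) q ->
  'C(#|W|, q) <= #|D| + 'C(#|W :\: P|, q).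
Proof.
rewrite -!card_ksub => /subset_leq_card /leq_trans; apply.
exact: (leq_card_setU _ _).1.
Qed.

(** Inclusion-exclusion: avoiding both [P1] and [P2] means avoiding their union. *)
Lemma card_avoid2 W q P1 P2 :
  #|ksub (W :\: P1) q :|: ksub (W :\: P2) q| + 'C(#|W :\: (P1 :|: P2)|, q) =
  'C(#|W :\: P1|, q) + 'C(#|W :\: P2|, q).
Proof.
rewrite -!card_ksub -[RHS]cardsUI; congr (_ + _); apply: eq_card => Q.
by rewrite !inE setDUr subsetI; case: (Q \subset _); case: (Q \subset _); case: (_ == _).
Qed.

Lemma card_hits2 D W q P1 P2 : D \subset ksub W q -> hits D P1 -> hits D P2 ->
  #|D| + 'C(#|W :\: P1|, q) + 'C(#|W :\: P2|, q) <=
  'C(#|W|, q) + 'C(#|W :\: (P1 :|: P2)|, q).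
Proof.
move=> DW h1 h2; rewrite -addnA -card_avoid2 addnA leq_add2r -(card_ksub W).
set U := _ :|: _.
have : [disjoint D & U].
  rewrite -setI_eq0 setIUr setU_eq0 !setI_eq0.
  by apply/andP; split; apply: hits_disj.
move/cardsU_disj <-; by apply: subset_leq_card; rewrite !subUset DW !ksubS ?subsetDl.
Qed.

(* Strict because some [q]-set meets [P1] and [P2] but not [P3]. *)
Lemma card_hits2_strict D W q P1 P2 P3 k : D \subset ksub W q ->
  hits D P1 -> hits D P2 -> hits D P3 ->
  P1 \in ksub W k -> P2 \in ksub W k -> P3 \in ksub W k ->
  P1 != P3 -> P2 != P3 -> 2 <= q -> q + k <= #|W| ->
  #|D| + 'C(#|W :\: P1|, q) + 'C(#|W :\: P2|, q) <
  'C(#|W|, q) + 'C(#|W :\: (P1 :|: P2)|, q).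
Proof.
move=> DW h1 h2 h3 /ksubP[W1 c1] /ksubP[W2 c2] /ksubP[W3 c3] n13 n23 q2 qk.
have pick P : P \subset W -> #|P| = k -> P != P3 -> exists2 a, a \in P & a \in W :\: P3.
  move=> PW cP nP; have : ~~ (P \subset P3).
    by apply: contra nP => PP; rewrite eqEcard PP cP c3 /=.
  case/subsetPn=> a aP a3; exists a => //; rewrite inE a3 /=; exact: (subsetP PW).
have [a a1 aW] := pick _ W1 c1 n13; have [b b2 bW] := pick _ W2 c2 n23.
have [Q Qab /ksubP[QW cQ]] : exists2 Q : {set X}, [set a; b] \subset Q & Q \in ksub (W :\: P3) q.
  have sab : [set a; b] \subset W :\: P3 by rewrite subUset !sub1set aW.
  (* [a] and [b] may coincide, so the padding of [Q] is computed from the actual size of the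
     pair. *)
  have cab : #|[set a; b]| <= 2 by rewrite cards2; case: (_ == _).
  have cW : #|W :\: P3| = #|W| - k by rewrite cardsD (setIidPr W3) c3.
  pose S := (W :\: P3) :\: [set a; b].
  have cS : #|S| = #|W| - k - #|[set a; b]| by rewrite cardsD (setIidPr sab) cW.
  have : 0 < #|ksub S (q - #|[set a; b]|)|.
    rewrite card_ksub bin_gt0 cS; move: cab qk q2; clear.
    by move: #|[set a; b]| #|W| => c w; lia.
  case/card_gt0P=> R /ksubP[RS cR]; exists ([set a; b] :|: R); first exact: subsetUl.
  apply/ksubP; split; first by rewrite subUset sab (subset_trans RS) ?subsetDl.
  rewrite cardsU cR; move: RS; rewrite subsetD => /andP[_].
  rewrite disjoint_sym -setI_eq0 => /eqP ->.
  by rewrite cards0 subn0 subnKC // (leq_trans cab).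
have QD : Q \notin D.
  apply/negP=> /h3; rewrite setI_eq0.
  by move: QW; rewrite subsetD => /andP[_ ->].
have DQW : Q |: D \subset ksub W q.
  rewrite subUset sub1set DW andbT; apply/ksubP; split=> //.
  exact: subset_trans QW (subsetDl _ _).
have aQ : a \in Q by apply: (subsetP Qab); rewrite !inE eqxx.
have bQ : b \in Q by apply: (subsetP Qab); rewrite !inE eqxx orbT.
(* The strict bound for [D] is the weak bound for [D] enlarged by the new set [Q], which meets [P1]
   in [a] and [P2] in [b]. *)
have -> : #|D| + 'C(#|W :\: P1|, q) + 'C(#|W :\: P2|, q) < 'C(#|W|, q) +
  'C(#|W :\: (P1 :|: P2)|, q) = (#|Q |: D| + 'C(#|W :\: P1|, q) + 'C(#|W :\: P2|, q)
  <= 'C(#|W|, q) + 'C(#|W :\: (P1 :|: P2)|, q)) by rewrite cardsU1 QD -!addnA.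
apply: (card_hits2 DQW) => S /setU1P[->|]; [|exact: h1| |exact: h2].
  by apply/set0Pn; exists a; rewrite inE aQ.
by apply/set0Pn; exists b; rewrite inE bQ.
Qed.

Lemma cardsU_neq P1 P2 k : #|P1| = k -> #|P2| = k -> P1 != P2 -> k < #|P1 :|: P2|.
Proof.
move=> c1 c2 n12; rewrite -c1; apply: proper_card; rewrite properEneq subsetUl andbT.
apply: contra n12 => /eqP E.
have s : P2 \subset P1 by rewrite E subsetUr.
by rewrite eq_sym eqEcard s c1 c2 /=.
Qed.

Lemma bin_pred n q : 0 < n -> 'C(n, q.+1) = 'C(n - 1, q.+1) + 'C(n - 1, q).
Proof. by case: n => // n _; rewrite binS subn1. Qed.

(* [card_hits2] is weakest for [#|P1 :|: P2| = k.+1]; this is that case after Pascal's rule. *)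
Lemma two_hits D W q P1 P2 k : D \subset ksub W q.+1 -> hits D P1 -> hits D P2 ->
  P1 \in ksub W k -> P2 \in ksub W k -> P1 != P2 ->
  #|D| + 'C(#|W| - k, q.+1) + 'C(#|W| - k - 1, q) <= 'C(#|W|, q.+1).
Proof.
move=> DW h1 h2 /ksubP[W1 c1] /ksubP[W2 c2] n12.
have := card_hits2 DW h1 h2.
have U : P1 :|: P2 \subset W by rewrite subUset W1.
rewrite !cardsD (setIidPr W1) (setIidPr W2) (setIidPr U) c1 c2.
have cU := cardsU_neq c1 c2 n12; have := subset_leq_card U.
move=> cUW; have le : #|W| - #|P1 :|: P2| <= #|W| - k - 1.
  by move: cU cUW; clear; lia.
by have := leq_bin2l q.+1 le; rewrite (@bin_pred (#|W| - k)); move: cU cUW; clear; lia.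
Qed.

(** A union of [k + 2] or more points would leave slack ['C(#|W| - k - 2, q)], which the size
    hypothesis makes positive. *)
Lemma two_hits_eq D W q P1 P2 k : D \subset ksub W q.+1 -> hits D P1 -> hits D P2 ->
  P1 \in ksub W k -> P2 \in ksub W k -> P1 != P2 -> q.+1 + k < #|W| ->
  #|D| + 'C(#|W| - k, q.+1) + 'C(#|W| - k - 1, q) = 'C(#|W|, q.+1) ->
  #|P1 :|: P2| = k.+1.
Proof.
move=> DW h1 h2 /ksubP[W1 c1] /ksubP[W2 c2] n12 qk.
have := card_hits2 DW h1 h2.
have U : P1 :|: P2 \subset W by rewrite subUset W1.
rewrite !cardsD (setIidPr W1) (setIidPr W2) (setIidPr U) c1 c2.
have cU := cardsU_neq c1 c2 n12; have := subset_leq_card U => cUW.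
have [//|nE] := eqVneq #|P1 :|: P2| k.+1.
have lt : #|W| - #|P1 :|: P2| <= #|W| - k - 2 by lia.
have := leq_bin2l q.+1 lt.
have : 0 < 'C(#|W| - k - 2, q) by rewrite bin_gt0; lia.
have E : #|W| - k - 1 - 1 = #|W| - k - 2 by lia.
rewrite (@bin_pred (#|W| - k)) ?(@bin_pred (#|W| - k - 1)) ?E; lia.
Qed.

Lemma three_hits D W q P1 P2 P3 k : D \subset ksub W q.+1 ->
  hits D P1 -> hits D P2 -> hits D P3 ->
  P1 \in ksub W k -> P2 \in ksub W k -> P3 \in ksub W k ->
  P1 != P2 -> P1 != P3 -> P2 != P3 -> 1 <= q -> q.+1 + k <= #|W| ->
  #|D| + 'C(#|W| - k, q.+1) + 'C(#|W| - k - 1, q) < 'C(#|W|, q.+1).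
Proof.
move=> DW h1 h2 h3 K1 K2 K3 n12 n13 n23 q2 qk.
have := card_hits2_strict DW h1 h2 h3 K1 K2 K3 n13 n23 q2 qk.
case/ksubP: K1 => W1 c1; case/ksubP: K2 => W2 c2.
have U : P1 :|: P2 \subset W by rewrite subUset W1.
rewrite !cardsD (setIidPr W1) (setIidPr W2) (setIidPr U) c1 c2.
have cU := cardsU_neq c1 c2 n12; have := subset_leq_card U.
move=> cUW; have le : #|W| - #|P1 :|: P2| <= #|W| - k - 1.
  by move: cU cUW; clear; lia.
by have := leq_bin2l q.+1 le; rewrite (@bin_pred (#|W| - k)); move: cU cUW; clear; lia.
Qed.

(** The complement of a member of [B] cannot lie in [A], so [A] and the complements of [B] are
    disjoint families of [l]-sets. *)
Lemma cross_compl A B V l : A \subset ksub V l -> B \subset ksub V l -> cross A B ->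
  #|V| = 2 * l -> #|A| + #|B| <= 'C(#|V|, l).
Proof.
move=> AV BV AB cV; pose c F := V :\: F.
have cK : {in ksub V l, involutive c}.
  by move=> F /ksubP[FV _]; rewrite /c setDDr setDv set0U; apply/setIidPr.
have sub1 : c @: B \subset ksub V l.
  apply/subsetP=> _ /imsetP[F /(subsetP BV)/ksubP[FV cF] ->]; apply/ksubP.
  by rewrite subsetDl cardsD (setIidPr FV) cF cV; split=> //; lia.
have -> : #|B| = #|c @: B|.
  rewrite card_in_imset // => F G /(subsetP BV) FB /(subsetP BV) GB /(congr1 c).
  by rewrite !cK.
have : [disjoint A & c @: B].
  apply/pred0P => F /=; apply/negbTE/negP => /andP[FA /imsetP[G GB EF]].
  apply: (cross_disj AB FA GB); rewrite EF disjoint_sym -setI_eq0.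
  by rewrite setIDA [G :&: V]setIC -setIDA setDv setI0.
move/cardsU_disj <-; by rewrite -card_ksub subset_leq_card // subUset AV.
Qed.

End Basic.

(** * Shifting *)

Section Shift.
Variable X : finType.
Implicit Types (A B D H : {set {set X}}) (F G P Q R S V W e : {set X}) (l k m n : nat) (x y v : X).

Definition swap x y F : {set X} := [set z | tperm x y z \in F].

Lemma swapK x y : involutive (swap x y).
Proof. by move=> F; apply/setP => z; rewrite !inE tpermK. Qed.

Lemma swap_memL x y F : (x \in swap x y F) = (y \in F).
Proof. by rewrite inE tpermL. Qed.

Lemma swap_memR x y F : (y \in swap x y F) = (x \in F).
Proof. by rewrite inE tpermR. Qed.

Lemma swap_mem x y z F : z != x -> z != y -> (z \in swap x y F) = (z \in F).
Proof. by move=> zx zy; rewrite inE tpermD // eq_sym. Qed.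

Lemma card_swap x y F : #|swap x y F| = #|F|.
Proof.
rewrite -(card_imset (mem F) (@perm_inj _ (tperm x y))).
apply: eq_card => z; rewrite inE; apply/idP/imsetP => [zF|[t tF ->]].
  by exists (tperm x y z); rewrite ?tpermK.
by rewrite tpermK.
Qed.

Lemma swapI x y F G : swap x y (F :&: G) = swap x y F :&: swap x y G.
Proof. by apply/setP => z; rewrite !inE. Qed.

Lemma swap_id x y F : (x \in F) = (y \in F) -> swap x y F = F.
Proof. by move=> E; apply/setP => z; rewrite inE; case: tpermP => // ->. Qed.

Lemma swap_eq0 x y F : (swap x y F == set0) = (F == set0).
Proof. by rewrite -!cards_eq0 card_swap. Qed.

Lemma swap_sub x y F V : x \in V -> y \in V -> F \subset V -> swap x y F \subset V.
Proof.
move=> xV yV /subsetP FV; apply/subsetP=> z; rewrite inE; case: tpermP => [->|->|_ _] //.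
exact: FV.
Qed.

(** The classical compression: [y] is replaced by [x] unless the result is already a member, which
    keeps the map injective. *)
Definition moves x y A F := [&& y \in F, x \notin F & swap x y F \notin A].
Definition shift_set x y A F := if moves x y A F then swap x y F else F.
Definition shift x y A : {set {set X}} := shift_set x y A @: A.

Lemma shift_set_inj x y A : {in A &, injective (shift_set x y A)}.
Proof.
move=> F G FA GA; rewrite /shift_set.
case: ifP => [/and3P[_ _ FN]|_]; case: ifP => [/and3P[_ _ GN]|_] //.
- by move/(congr1 (swap x y)); rewrite !swapK.
- by move=> E; rewrite E GA in FN.
- by move=> E; rewrite -E FA in GN.
Qed.

Lemma card_shift x y A : #|shift x y A| = #|A|.
Proof. by rewrite card_in_imset //; apply: shift_set_inj. Qed.

Lemma shift_sub x y A V l : x \in V -> y \in V -> A \subset ksub V l -> shift x y A \subset ksub V l.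
Proof.
move=> xV yV /subsetP AV; apply/subsetP=> _ /imsetP[F /AV/ksubP[FV cF] ->].
by apply/ksubP; rewrite /shift_set; case: ifP => _; rewrite ?card_swap; split=> //; apply: swap_sub.
Qed.

(** The mixed case. If [x] is not in [G], then [swap x y G] is itself in [B], because its move was
    blocked or because [G] misses both points; swapping the intersection back reduces to [F] and
    that member. *)
Lemma shift_cross1 x y A B F G : cross A B -> F \in A -> G \in B ->
  moves x y A F -> ~~ moves x y B G -> swap x y F :&: G != set0.
Proof.
move=> AB FA GB /and3P[yF xF _] mG.
have [xG|xG] := boolP (x \in G).
  by apply/set0Pn; exists x; rewrite inE swap_memL yF.
rewrite -(swapK x y G) -swapI swap_eq0; apply: (AB) => //.
have [yG|yG] := boolP (y \in G).
  by move: mG; rewrite /moves yG xG /= negbK.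
by rewrite swap_id // (negPf xG) (negPf yG).
Qed.

Lemma shift_cross x y A B : cross A B -> cross (shift x y A) (shift x y B).
Proof.
move=> AB _ _ /imsetP[F FA ->] /imsetP[G GB ->]; rewrite /shift_set.
case: ifPn => [mF|mF]; case: ifPn => [mG|mG].
- by rewrite -swapI swap_eq0; apply: AB.
- exact: shift_cross1 mF mG.
- by rewrite setIC; apply: shift_cross1 mG mF => //; apply: crossC.
- exact: AB.
Qed.

Lemma shiftP x y A F : x != y ->
  (F \in shift x y A) =
  (if (x \in F) && (y \notin F) then (F \in A) || (swap x y F \in A)
   else if (y \in F) && (x \notin F) then (F \in A) && (swap x y F \in A)
   else F \in A).
Proof.
move=> nxy; apply/imsetP/idP => [[G GA ->]|].
  rewrite /shift_set; case: (boolP (moves x y A G)) => [/and3P[yG xG nG]|].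
    by rewrite swap_memL swap_memR yG xG /= swapK GA orbT.
  by rewrite /moves !GA /=; case: (x \in G); case: (y \in G) => //=; rewrite negbK.
case: ifPn => [/andP[xF yF] /orP[FA|sA]|nxyF].
- by exists F => //; rewrite /shift_set /moves xF andbF.
- have [FA|FN] := boolP (F \in A).
    by exists F => //; rewrite /shift_set /moves xF andbF.
  by exists (swap x y F) => //; rewrite /shift_set /moves swap_memL swap_memR swapK xF yF FN.
case: ifPn => [/andP[yF xF] /andP[FA sA]|nyxF FA].
  by exists F => //; rewrite /shift_set /moves sA !andbF.
by exists F => //; rewrite /shift_set /moves andbA (negPf nyxF).
Qed.

Definition rank x : nat := enum_rank x.

Lemma rank_inj x y : rank x = rank y -> x = y.
Proof. by move/ord_inj/enum_rank_inj. Qed.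

Definition stable V A := forall x y F, x \in V -> y \in V -> rank x < rank y ->
  F \in A -> y \in F -> x \notin F -> swap x y F \in A.

Definition weight F := \sum_(z in F) rank z.

Lemma weight_swap x y F : rank x < rank y -> y \in F -> x \notin F -> weight (swap x y F) < weight F.
Proof.
move=> lt yF xF; rewrite /weight (bigD1 x) ?swap_memL //= [X in _ < X](bigD1 y) //=.
rewrite -addSn; apply: leq_add => //; rewrite leq_eqVlt; apply/orP; left; apply/eqP.
apply: eq_bigl => z; have [->|nx] := eqVneq z x.
  by rewrite andbF (negPf xF).
have [->|ny] := eqVneq z y; first by rewrite swap_memR (negPf xF) andbF.
by rewrite swap_mem.
Qed.

(** The termination measure of shifting: it drops whenever some member really moves. *)
Definition potential A := \sum_(F in A) weight F.

Lemma potential_shift_le x y A : rank x < rank y -> potential (shift x y A) <= potential A.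
Proof.
move=> lt; rewrite /potential big_imset /=; last exact: shift_set_inj.
apply: leq_sum => F FA; rewrite /shift_set; case: ifP => // /and3P[yF xF _].
exact: ltnW (weight_swap lt yF xF).
Qed.

Lemma potential_shift_lt x y A F : rank x < rank y -> F \in A -> moves x y A F ->
  potential (shift x y A) < potential A.
Proof.
move=> lt FA mF; rewrite /potential big_imset /=; last exact: shift_set_inj.
rewrite (bigD1 F) //= [X in _ < X](bigD1 F) //= -addSn; apply: leq_add.
  by rewrite /shift_set mF; case/and3P: mF => yF xF _; apply: weight_swap.
apply: leq_sum => G _; rewrite /shift_set; case: ifP => // /and3P[yF xF _].
exact: ltnW (weight_swap lt yF xF).
Qed.

Lemma stable_or_moves V A : stable V A \/
  exists x y F, [/\ x \in V, y \in V, rank x < rank y, F \in A & moves x y A F].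
Proof.
have [/existsP[x /existsP[y /existsP[F /and5P[]]]]|none] :=
  boolP [exists x, exists y, exists F : {set X},
    [&& x \in V, y \in V, rank x < rank y, F \in A & moves x y A F]].
  by right; exists x, y, F.
left=> x y F xV yV lt FA yF xF; apply/negPn/negP => nA; case/negP: none.
by apply/existsP; exists x; apply/existsP; exists y; apply/existsP; exists F; apply/and5P; split=> //; apply/and3P.
Qed.

(** Both families undergo the same shift, since only simultaneous shifts keep them
    cross-intersecting. One potential drops and the other does not grow, so their sum is the
    measure. *)
Lemma shift_ind V (P : {set {set X}} -> {set {set X}} -> Prop) :
  (forall A B, stable V A -> stable V B -> P A B) ->
  (forall A B x y, x \in V -> y \in V -> rank x < rank y ->
     P (shift x y A) (shift x y B) -> P A B) ->
  forall A B, P A B.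
Proof.
move=> Pst Psh A B; have [n] := ubnP (potential A + potential B).
elim: n A B => // n IH A B; rewrite ltnS => le.
have [sA|[x [y [F [xV yV lt FA mF]]]]] := stable_or_moves V A; last first.
  apply: (Psh A B x y) => //; apply: IH; apply: leq_trans le.
  by rewrite -addSn leq_add ?potential_shift_le ?(potential_shift_lt lt FA mF).
have [sB|[x [y [F [xV yV lt FB mF]]]]] := stable_or_moves V B; first exact: Pst.
apply: (Psh A B x y) => //; apply: IH; apply: leq_trans le.
by rewrite -addnS leq_add ?potential_shift_le ?(potential_shift_lt lt FB mF).
Qed.

Lemma stable_del V A v : stable V A -> stable (V :\ v) (del A v).
Proof.
move=> sA x y F /setD1P[xv xV] /setD1P[yv yV] lt /delP[FA vF] yF xF; apply/delP.
by split; [apply: sA | rewrite swap_mem // eq_sym].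
Qed.

Lemma swapU1 x y v F : v != x -> v != y -> swap x y (v |: F) = v |: swap x y F.
Proof.
move=> vx vy; apply/setP => z; rewrite !inE; congr (_ || _).
case: tpermP => [->|->|//]; first by rewrite [y == _]eq_sym [x == _]eq_sym (negPf vx) (negPf vy).
by rewrite [y == _]eq_sym [x == _]eq_sym (negPf vx) (negPf vy).
Qed.

Lemma stable_link V A v : stable V A -> stable (V :\ v) (link A v).
Proof.
move=> sA x y F /setD1P[xv xV] /setD1P[yv yV] lt /linkP[vF FA] yF xF; apply/linkP.
rewrite swap_mem // 1?eq_sym // -swapU1 1?eq_sym //; split=> //.
by apply: sA; rewrite // !inE ?yF ?orbT // negb_or xv xF.
Qed.

Definition maxof V v := v \in V /\ forall u, u \in V -> u != v -> rank u < rank v.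

Lemma maxof_ex V : 0 < #|V| -> exists v, maxof V v.
Proof.
case/card_gt0P=> v0 v0V; case: (arg_maxnP rank v0V) => v vV vmax; exists v; split=> // u uV nuv.
rewrite ltn_neqAle; apply/andP; split; last exact: vmax.
by apply: contra nuv => /eqP/rank_inj ->.
Qed.

Lemma pick_out V F : #|F| < #|V| -> exists2 u, u \in V & u \notin F.
Proof.
move=> lt; have : ~~ (V \subset F) by apply: contraTN lt => /subset_leq_card; rewrite -leqNgt.
by case/subsetPn=> u; exists u.
Qed.

(** [S] collects [F] together with whatever else the point replacing [v] has to avoid. *)
Lemma stable_out V A v F S l : stable V A -> maxof V v -> A \subset ksub V l ->
  F \in A -> F \subset S -> #|S| < #|V| -> v \in F ->
  exists2 u, u \in V :\: S & swap u v F \in del A v.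
Proof.
move=> sA [vV vmax] AV FA FS lt vF; have [u uV uS] := pick_out lt.
have uF : u \notin F by apply: contra uS; apply/subsetP.
exists u; first by rewrite inE uS.
apply/delP; split; last by rewrite swap_memR.
apply: sA => //; apply: vmax => //; apply: contra uF => /eqP -> //.
Qed.

Lemma stable_avoid V A v F S l : stable V A -> maxof V v -> A \subset ksub V l ->
  F \in A -> [disjoint F & S] -> l + #|S| < #|V| ->
  exists2 G, G \in del A v & [disjoint G & S].
Proof.
move=> sA vV AV FA dFS lt; have [vF|vF] := boolP (v \in F); last first.
  by exists F => //; apply/delP.
have [] := @stable_out V A v F (F :|: S) l => //; first exact: subsetUl.
  by have /ksubP[_ cF] := subsetP AV _ FA; rewrite cardsU cF (leq_ltn_trans _ lt) // leq_subr.
move=> u /setDP[uV uN] GA; move: uN; rewrite inE negb_or => /andP[uF uS]; exists (swap u v F) => //.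
apply/pred0P => z /=; apply/negbTE/negP => /andP[zG zS].
have [E|zu] := eqVneq z u; first by rewrite -E zS in uS.
have [E|zv] := eqVneq z v; first by rewrite E swap_memR (negPf uF) in zG.
by rewrite swap_mem // in zG; move/pred0P: dFS => /(_ z) /=; rewrite zG zS.
Qed.

(** If two link members [F] and [G] were disjoint, then [v |: (F :|: G)] would have [2 * l + 1]
    points and miss some [u] of [V]. Trading [v] for [u] in [v |: F] gives a member of [A] disjoint
    from [v |: G]. *)
Lemma stable_link_cross V A B v l : stable V A -> maxof V v ->
  A \subset ksub V l.+1 -> B \subset ksub V l.+1 -> cross A B -> 2 * l.+1 <= #|V| ->
  cross (link A v) (link B v).
Proof.
move=> sA vmax AV BV AB le F G /linkP[vF FA] /linkP[vG GB]; apply/negP => /eqP dFG.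
have [_ cF] := ksubP _ _ _ (subsetP AV _ FA); have [_ cG] := ksubP _ _ _ (subsetP BV _ GB).
rewrite cardsU1 vF add1n in cF; case: cF => cF; rewrite cardsU1 vG add1n in cG; case: cG => cG.
have [] := @stable_out V A v (v |: F) (v |: (F :|: G)) l.+1 => //.
- exact: setUS (subsetUl _ _).
- rewrite cardsU1 !inE negb_or vF vG cardsU dFG cards0 cF cG; lia.
- by rewrite !inE eqxx.
move=> u /setDP[uV uS] /delP[sFA _]; move: uS; rewrite !inE !negb_or => /and3P[uv uF uG].
apply: (cross_disj AB sFA GB); apply/pred0P => z /=; apply/negbTE/negP => /andP[].
rewrite inE; case: tpermP => [-> _|-> uvF _|].
- by rewrite !inE (negPf uv) (negPf uG).
- by move: uvF; rewrite !inE (negPf uv) (negPf uF).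
move=> _ /eqP zv; rewrite !inE (negPf zv) /= => zF zG.
by move/setP/(_ z): dFG; rewrite !inE zF zG.
Qed.

(** A single member [F] through [v] already supplies enough members avoiding [v]: trade [v] for each
    of the points outside [F]. *)
Lemma stable_del_card V A v l j : stable V A -> maxof V v -> A \subset ksub V l ->
  l + j <= #|V| -> j <= #|A| -> j <= #|del A v|.
Proof.
move=> sA vmax AV le jA.
have [E|] := eqVneq (link A v) set0; first by rewrite (card_del_link A v) E cards0 addn0 in jA.
case/set0Pn=> R /linkP[vR RA]; have [_ cF] := ksubP _ _ _ (subsetP AV _ RA).
set F := v |: R in RA cF; have vF : v \in F by rewrite !inE eqxx.
have sub : (fun u => swap u v F) @: (V :\: F) \subset del A v.
  apply/subsetP=> _ /imsetP[u /setDP[uV uF] ->]; apply/delP; rewrite swap_memR; split=> //.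
  case: vmax => vV vmax; apply: sA => //; apply: vmax => //.
  by apply: contra uF => /eqP ->.
apply: leq_trans (subset_leq_card sub); rewrite card_in_imset.
  rewrite cardsD; apply: leq_trans (leq_sub2l _ (subset_leq_card (subsetIr V F))).
  by rewrite cF leq_subRL //; apply: leq_trans le; apply: leq_addr.
move=> u w /setDP[uV uF] /setDP[wV wF] E.
have : u \in swap u v F by rewrite swap_memL.
rewrite E inE; case: tpermP => [//|E2|_ _]; last by rewrite (negPf uF).
by rewrite E2 vF in uF.
Qed.

End Shift.

(** * Cross-intersecting pairs of uniform families *)

Section Cross.
Variable X : finType.
Implicit Types (A B D H : {set {set X}}) (F G P Q R S V W e : {set X}) (l k m n : nat) (x y v : X).

Lemma link_hits A B v F : cross A B -> F \in del A v -> hits (link B v) F.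
Proof.
move=> AB /delP[FA vF] R /linkP[vR RB]; have [z zF] := cross_mem AB FA RB.
case/setU1P => [E|zR]; first by rewrite -E zF in vF.
by apply/set0Pn; exists z; rewrite inE zR.
Qed.

Lemma link_two_hits A B V v k q : cross A B -> A \subset ksub V k -> B \subset ksub V q.+2 ->
  2 <= #|del A v| ->
  #|link B v| + 'C(#|V :\ v| - k, q.+1) + 'C(#|V :\ v| - k - 1, q) <= 'C(#|V :\ v|, q.+1).
Proof.
move=> AB AV BV /card_gt1P[P1 [P2 [P1A P2A n12]]]; have sA := subsetP (del_sub v AV).
apply: (@two_hits _ _ _ _ P1 P2) (n12); [exact: link_sub| | |exact: sA|exact: sA].
  exact: link_hits AB P1A.
exact: link_hits AB P2A.
Qed.

Lemma link_three_hits A B V v k q : cross A B -> A \subset ksub V k -> B \subset ksub V q.+2 ->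
  3 <= #|del A v| -> 1 <= q -> q.+1 + k <= #|V :\ v| ->
  #|link B v| + 'C(#|V :\ v| - k, q.+1) + 'C(#|V :\ v| - k - 1, q) < 'C(#|V :\ v|, q.+1).
Proof.
move=> AB AV BV /card_gt2P[P1 [P2 [P3 [[K1 K2 K3] [n12 n23 n31]]]]] q1 le.
have sA := subsetP (del_sub v AV); rewrite eq_sym in n31.
apply: (@three_hits _ _ _ _ P1 P2 P3 _ (link_sub v BV)); rewrite ?sA //.
- exact: link_hits AB K1.
- exact: link_hits AB K2.
- exact: link_hits AB K3.
Qed.

Lemma link_card_hits A B V v k q : cross A B -> A \subset ksub V k -> B \subset ksub V q.+1 ->
  0 < #|del A v| -> #|link B v| + 'C(#|V :\ v| - k, q) <= 'C(#|V :\ v|, q).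
Proof.
move=> AB AV BV /card_gt0P[P PA]; have [PV cP] := ksubP _ _ _ (subsetP (del_sub v AV) _ PA).
have := card_hits (link_sub v BV) (link_hits AB PA).
by rewrite cardsD (setIidPr PV) cP.
Qed.

Lemma card_D1 V v m : v \in V -> #|V| = m.+1 -> #|V :\ v| = m.
Proof. by move=> vV; rewrite (cardsD1 v) vV => -[]. Qed.

(** The extremal pair is one set together with all sets meeting it. After Pascal's rule only the
    links remain to be estimated, at rank one lower. *)
Lemma crossHM_stable l V A B : stable V A -> stable V B ->
  A \subset ksub V l -> B \subset ksub V l -> cross A B -> 2 * l <= #|V| ->
  0 < #|A| -> 0 < #|B| -> #|A| + #|B| + 'C(#|V| - l, l) <= 'C(#|V|, l) + 1.
Proof.
have [m cV] : exists m, #|V| = m by exists #|V|.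
elim: m l V A B cV => [|m IH] l V A B cV sA sB AV BV AB le A0 B0; rewrite cV in le *.
  have l0 : l = 0 by lia.
  subst l; have := @cross_compl _ A B V 0 AV BV AB; rewrite cV => /(_ erefl).
  rewrite !bin0; lia.
have [v vmax] : exists v, maxof V v by apply: maxof_ex; rewrite cV.
have vV : v \in V by case: vmax.
have cW := card_D1 vV cV.
have [E|lt] := eqVneq m.+1 (2 * l).
  have := @cross_compl _ A B V l AV BV AB; rewrite cV E => /(_ erefl).
  have -> : 2 * l - l = l by lia.
  rewrite binn; lia.
have dA : 0 < #|del A v| by apply: (stable_del_card sA vmax AV) => //; rewrite cV; lia.
have dB : 0 < #|del B v| by apply: (stable_del_card sB vmax BV) => //; rewrite cV; lia.
have dAB : cross (del A v) (del B v) by apply: cross_sub AB; apply: sub_del.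
have := IH l _ _ _ cW (stable_del sA) (stable_del sB) (del_sub v AV) (del_sub v BV) dAB.
rewrite cW => /(_ _ dA dB); have le' : 2 * l <= m by lia.
move/(_ le'); case: l le lt AV BV le' => [|l] le lt AV BV le'.
  rewrite !bin0; lia.
rewrite (card_del_link A v) (card_del_link B v) [in 'C(m.+1, _)]binS.
rewrite (@bin_pred (m.+1 - l.+1)); last by lia.
have -> : m.+1 - l.+1 - 1 = m - l.+1 by lia.
have lAB : cross (link A v) (link B v) by apply: (stable_link_cross sA vmax AV BV AB); rewrite cV.
have hB := link_card_hits AB AV BV dA; have hA := link_card_hits (crossC AB) BV AV dB.
rewrite cW in hA hB.
(* If one link is empty, the other one is small enough because it meets a member of the opposite
   deletion. *)
have [A1|A1] := posnP #|link A v|; first by lia.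
have [B1|B1] := posnP #|link B v|; first by lia.
have := IH l _ _ _ cW (stable_link sA) (stable_link sB) (link_sub v AV) (link_sub v BV) lAB.
rewrite cW => /(_ _ A1 B1); have le2 : 2 * l <= m by lia.
move/(_ le2); case: l {IH lt AV BV} le le' hA hB le2 => [|l] le le' hA hB le2.
  rewrite !bin0; lia.
rewrite (@bin_pred (m - l.+1)); last by lia.
have -> : m - l.+1 - 1 = m - l.+2 by lia.
have : 0 < 'C(m - l.+2, l) by rewrite bin_gt0; lia.
lia.
Qed.

Lemma crossHM l V A B : A \subset ksub V l -> B \subset ksub V l -> cross A B ->
  2 * l <= #|V| -> 0 < #|A| -> 0 < #|B| -> #|A| + #|B| + 'C(#|V| - l, l) <= 'C(#|V|, l) + 1.
Proof.
pattern A, B; apply: (@shift_ind _ V) => {}A {}B.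
  by move=> sA sB AV BV AB le; apply: crossHM_stable.
move=> x y xV yV lt IH AV BV AB le A0 B0; move: IH; rewrite !card_shift; apply=> //.
- exact: shift_sub.
- exact: shift_sub.
- exact: shift_cross.
Qed.

(** If one link is empty, the other meets two members of the opposite deletion. If neither is, the
    Hilton-Milner bound suffices, so the links need no second member. The rank starts at 3 because
    common stars violate the estimate for graphs. *)
Lemma cross_ge2_stable l V A B : stable V A -> stable V B ->
  A \subset ksub V l.+3 -> B \subset ksub V l.+3 -> cross A B -> 2 * l.+3 <= #|V| ->
  2 <= #|A| -> 2 <= #|B| ->
  #|A| + #|B| + 'C(#|V| - l.+3, l.+3) + 'C(#|V| - l.+3 - 1, l.+2) <= 'C(#|V|, l.+3) + 2.
Proof.
have [m cV] : exists m, #|V| = m by exists #|V|.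
elim: m V A B cV => [|m IH] V A B cV sA sB AV BV AB le A0 B0; rewrite cV in le *; first by lia.
have [v vmax] : exists v, maxof V v by apply: maxof_ex; rewrite cV.
have vV : v \in V by case: vmax.
have cW := card_D1 vV cV.
have [E|lt] := eqVneq m.+1 (2 * l.+3).
  have := @cross_compl _ A B V l.+3 AV BV AB; rewrite cV E => /(_ erefl).
  have -> : 2 * l.+3 - l.+3 = l.+3 by lia.
  rewrite subn1 /= !binn; lia.
have dA : 2 <= #|del A v| by apply: (stable_del_card sA vmax AV) => //; rewrite cV; lia.
have dB : 2 <= #|del B v| by apply: (stable_del_card sB vmax BV) => //; rewrite cV; lia.
have dAB : cross (del A v) (del B v) by apply: cross_sub AB; apply: sub_del.
have := IH _ _ _ cW (stable_del sA) (stable_del sB) (del_sub v AV) (del_sub v BV) dAB.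
rewrite cW => /(_ _ dA dB); have le' : 2 * l.+3 <= m by lia.
move/(_ le').
rewrite (card_del_link A v) (card_del_link B v) [in 'C(m.+1, _)]binS.
rewrite (@bin_pred (m.+1 - l.+3 - 1)) ?(@bin_pred (m.+1 - l.+3)); [|lia..].
have -> : m.+1 - l.+3 - 1 = m - l.+3 by lia.
have lAB : cross (link A v) (link B v) by apply: (stable_link_cross sA vmax AV BV AB); rewrite cV.
have hB := link_two_hits AB AV BV dA; have hA := link_two_hits (crossC AB) BV AV dB.
rewrite cW in hA hB.
have [A1|A1] := posnP #|link A v|; first by lia.
have [B1|B1] := posnP #|link B v|; first by lia.
have := @crossHM l.+2 _ _ _ (link_sub v AV) (link_sub v BV) lAB.
rewrite cW => /(_ _ A1 B1); have le2 : 2 * l.+2 <= m by lia.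
move/(_ le2).
rewrite (@bin_pred (m - l.+2)); last by lia.
have -> : m - l.+2 - 1 = m - l.+3 by lia.
rewrite (@bin_pred (m - l.+3) l); last by lia.
have : 0 < 'C(m - l.+3 - 1, l) by rewrite bin_gt0; lia.
lia.
Qed.

Lemma cross_ge2 l V A B : A \subset ksub V l.+3 -> B \subset ksub V l.+3 -> cross A B ->
  2 * l.+3 <= #|V| -> 2 <= #|A| -> 2 <= #|B| ->
  #|A| + #|B| + 'C(#|V| - l.+3, l.+3) + 'C(#|V| - l.+3 - 1, l.+2) <= 'C(#|V|, l.+3) + 2.
Proof.
pattern A, B; apply: (@shift_ind _ V) => {}A {}B.
  by move=> sA sB AV BV AB le; apply: cross_ge2_stable.
move=> x y xV yV lt IH AV BV AB le A0 B0; move: IH; rewrite !card_shift; apply=> //.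
- exact: shift_sub.
- exact: shift_sub.
- exact: shift_cross.
Qed.

Lemma cross_ge3_stable l V A B : stable V A -> stable V B ->
  A \subset ksub V l.+4 -> B \subset ksub V l.+4 -> cross A B -> 2 * l.+4 < #|V| ->
  3 <= #|A| -> 3 <= #|B| ->
  #|A| + #|B| + 'C(#|V| - l.+4, l.+4) + 'C(#|V| - l.+4 - 1, l.+3) < 'C(#|V|, l.+4) + 2.
Proof.
move=> sA sB AV BV AB le A0 B0.
have [v vmax] : exists v, maxof V v by apply: maxof_ex; lia.
have vV : v \in V by case: vmax.
have [m cV] : exists m, #|V| = m.+1 by exists #|V|.-1; lia.
have cW := card_D1 vV cV; rewrite cV in le *.
have dA : 3 <= #|del A v| by apply: (stable_del_card sA vmax AV) => //; rewrite cV; lia.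
have dB : 3 <= #|del B v| by apply: (stable_del_card sB vmax BV) => //; rewrite cV; lia.
have dAB : cross (del A v) (del B v) by apply: cross_sub AB; apply: sub_del.
have := cross_ge2 (del_sub v AV) (del_sub v BV) dAB; rewrite cW.
move/(_ le (ltnW dA) (ltnW dB)).
rewrite (card_del_link A v) (card_del_link B v) [in 'C(m.+1, _)]binS.
rewrite (@bin_pred (m.+1 - l.+4 - 1)) ?(@bin_pred (m.+1 - l.+4)); [|lia..].
have -> : m.+1 - l.+4 - 1 = m - l.+4 by lia.
have lAB : cross (link A v) (link B v).
  by apply: (stable_link_cross sA vmax AV BV AB); rewrite cV; lia.
have hB := link_three_hits AB AV BV dA; have hA := link_three_hits (crossC AB) BV AV dB.
have le3 : l.+3 + l.+4 <= m by lia.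
rewrite cW in hA hB; move/(_ isT le3): hA => hA; move/(_ isT le3): hB => hB.
have [A1|A1] := posnP #|link A v|; first by lia.
have [B1|B1] := posnP #|link B v|; first by lia.
have := @crossHM l.+3 _ _ _ (link_sub v AV) (link_sub v BV) lAB.
rewrite cW => /(_ _ A1 B1); have le2 : 2 * l.+3 <= m by lia.
move/(_ le2).
rewrite (@bin_pred (m - l.+3)); last by lia.
have -> : m - l.+3 - 1 = m - l.+4 by lia.
rewrite (@bin_pred (m - l.+4) l.+1); last by lia.
(* One unit is lost to the [+ 1] of the Hilton-Milner bound, so strictness needs the spare binomial
   to be at least 2. *)
have le4 : l.+2 <= m - l.+4 - 1 by lia.
have := leq_bin2l l.+1 le4; rewrite binSn.
lia.
Qed.

Lemma cross_ge3 l V A B : A \subset ksub V l.+4 -> B \subset ksub V l.+4 -> cross A B ->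
  2 * l.+4 < #|V| -> 3 <= #|A| -> 3 <= #|B| ->
  #|A| + #|B| + 'C(#|V| - l.+4, l.+4) + 'C(#|V| - l.+4 - 1, l.+3) < 'C(#|V|, l.+4) + 2.
Proof.
pattern A, B; apply: (@shift_ind _ V) => {}A {}B.
  by move=> sA sB AV BV AB le; apply: cross_ge3_stable.
move=> x y xV yV lt IH AV BV AB le A0 B0; move: IH; rewrite !card_shift; apply=> //.
- exact: shift_sub.
- exact: shift_sub.
- exact: shift_cross.
Qed.

Lemma crossHM_strict l V A B : A \subset ksub V l.+3 -> B \subset ksub V l.+3 -> cross A B ->
  2 * l.+3 < #|V| -> 2 <= #|A| -> 2 <= #|B| ->
  #|A| + #|B| + 'C(#|V| - l.+3, l.+3) < 'C(#|V|, l.+3) + 1.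
Proof.
move=> AV BV AB lt A2 B2; have := cross_ge2 AV BV AB (ltnW lt) A2 B2.
have le : l.+3 <= #|V| - l.+3 - 1 by lia.
have := leq_bin2l l.+2 le; rewrite binSn; lia.
Qed.

(** An edge missing [a] would have to contain the other ends of three edges at [a]. *)
Lemma claw_center V A B a : A \subset ksub V 2 -> B \subset ksub V 2 -> cross A B ->
  3 <= #|[set F in B | a \in F]| -> {in A, forall F, a \in F}.
Proof.
move=> AV BV AB c3 F FA; apply/negPn/negP => aF.
have [_ cF] := ksubP _ _ _ (subsetP AV _ FA).
have sub : [set G in B | a \in G] \subset (fun z => [set a; z]) @: F.
  apply/subsetP=> G; rewrite inE => /andP[GB aG].
  have [z zF zG] := cross_mem AB FA GB; apply/imsetP; exists z => //.
  have [_ cG] := ksubP _ _ _ (subsetP BV _ GB).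
  have naz : a != z by apply: contra aF => /eqP ->.
  apply/eqP; rewrite eq_sym eqEcard cG cards2 naz subUset !sub1set aG zG //.
by have := leq_trans c3 (leq_trans (subset_leq_card sub) (leq_imset_card _ _)); rewrite cF.
Qed.

Lemma claw_center_both V A B a : A \subset ksub V 2 -> B \subset ksub V 2 -> cross A B ->
  3 <= #|A| -> 3 <= #|[set F in B | a \in F]| -> {in A :|: B, forall F, a \in F}.
Proof.
move=> AV BV AB A3 B3; have aA := claw_center AV BV AB B3.
have E : [set F in A | a \in F] = A.
  by apply/setP => F; rewrite inE; case: (boolP (F \in A)) => // /aA.
have aB := @claw_center V B A a BV AV (crossC AB); rewrite E in aB.
by move=> F /setUP[/aA|/(aB A3)].
Qed.

(** If no vertex has [B]-degree 3, an edge of [A] meets at most 2 + 2 members of [B]. Four members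
    then leave no slack, and this rigidity allows [A] only two edges. *)
Lemma graph_cross V A B : A \subset ksub V 2 -> B \subset ksub V 2 -> cross A B ->
  3 <= #|A| -> 4 <= #|B| -> exists a, {in A :|: B, forall F, a \in F}.
Proof.
move=> AV BV AB A3 B4.
have [/existsP[a a3]|no] := boolP [exists a, 3 <= #|[set F in B | a \in F]|].
  by exists a; apply: (claw_center_both AV BV AB A3 a3).
have deg a : #|[set F in B | a \in F]| <= 2.
  by rewrite leqNgt; apply: contra no => a3; apply/existsP; exists a.
have split2 a b F : F \in A -> F = [set a; b] ->
    [/\ #|[set G in B | a \in G]| = 2, #|[set G in B | b \in G]| = 2 &
        forall G, G \in B -> ~~ ((a \in G) && (b \in G))].
  move=> FA EF.
  have U : [set G in B | a \in G] :|: [set G in B | b \in G] = B.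
    apply/setP => G; rewrite !inE -andb_orr; case: (boolP (G \in B)) => //= GB.
    have [z] := cross_mem AB FA GB; rewrite EF => /set2P[] -> ->; rewrite ?orbT //.
  have := cardsUI [set G in B | a \in G] [set G in B | b \in G]; rewrite U.
  have := deg a; have := deg b => db da E.
  have I0 : #|[set G in B | a \in G] :&: [set G in B | b \in G]| = 0 by lia.
  split; [lia|lia|move=> G GB; apply/negP => ab].
  by move/cards0_eq/setP/(_ G): I0; rewrite !inE GB /= ab.
case/card_gt2P: A3 => e [e2 [e3 [[eA e2A e3A] [n12 n23 n31]]]].
have [_ /eqP/cards2P[a [b [nab Ee]]]] := ksubP _ _ _ (subsetP AV _ eA).
have [a2 b2 nab2] := split2 a b e eA Ee.
(* An edge of [A] other than [e] = {a, b} is disjoint from [e], hence consists of the two other ends at [a]. *)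
have avoid c d f : f \in A -> f != e -> e = [set c; d] ->
    #|[set G in B | d \in G]| = 2 -> c \notin f.
  move=> fA nfe Ecd d2; apply/negP => cf.
  have [c2' d2' ncd] := split2 c d e eA Ecd.
  have [_ cf2] := ksubP _ _ _ (subsetP AV _ fA).
  have [z Ef] : exists z, f = [set c; z].
    have [_ /eqP/cards2P[p [q [npq Ef]]]] := ksubP _ _ _ (subsetP AV _ fA).
    move: cf; rewrite Ef => /set2P[->|->]; [by exists q|by exists p; rewrite setUC].
  have nzd : z != d by apply: contra nfe => /eqP E; rewrite Ef Ecd E.
  have sub : [set G in B | d \in G] \subset [set [set d; z]].
    apply/subsetP=> G; rewrite !inE => /andP[GB dG].
    have [_ cG] := ksubP _ _ _ (subsetP BV _ GB).
    have [t tf tG] := cross_mem AB fA GB; move: tf; rewrite Ef => /set2P[Et|Et].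
      by have := ncd _ GB; rewrite -Et tG dG.
    rewrite eq_sym eqEcard cG cards2 eq_sym nzd subUset !sub1set dG -Et tG //.
  by have := subset_leq_card sub; rewrite cards1 d2.
have determined f : f \in A -> f != e -> f = \bigcup_(G in [set G in B | a \in G]) (G :\ a).
  move=> fA nfe; have af := avoid a b f fA nfe Ee b2.
  have [_ cf] := ksubP _ _ _ (subsetP AV _ fA).
  apply/eqP; rewrite eq_sym eqEcard cf; apply/andP; split.
    apply/bigcupsP => G; rewrite inE => /andP[GB aG].
    have [_ cG] := ksubP _ _ _ (subsetP BV _ GB).
    have [z zf zG] := cross_mem AB fA GB.
    have naz : a != z by apply: contra af => /eqP ->.
    have -> : G = [set a; z].
      by apply/eqP; rewrite eq_sym eqEcard cG cards2 naz subUset !sub1set aG zG.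
    by apply/subsetP=> t; rewrite !inE; case: (t == a) => //= /eqP ->.
  have /eqP/cards2P[G1 [G2 [nG EG]]] := a2.
  rewrite EG big_setU1 ?inE ?nG // big_set1.
  have mG : forall G, G \in [set G1; G2] -> a \in G /\ #|G| = 2.
    move=> G; rewrite -EG inE => /andP[GB ->]; split=> //.
    by have [] := ksubP _ _ _ (subsetP BV _ GB).
  have [a1 c1] : a \in G1 /\ #|G1| = 2 by apply: mG; rewrite !inE eqxx.
  have [aa2 c2] : a \in G2 /\ #|G2| = 2 by apply: mG; rewrite !inE eqxx orbT.
  apply: (@cardsU_neq _ _ _ 1).
  - by rewrite (cardsD1 a) a1 in c1; case: c1.
  - by rewrite (cardsD1 a) aa2 in c2; case: c2.
  by apply: contra nG => /eqP E; rewrite -(setD1K a1) E setD1K.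
rewrite eq_sym in n12.
by move: n23; rewrite (determined e2 e2A n12) (determined e3 e3A n31) eqxx.
Qed.

End Cross.

(** * Stable intersecting families *)

Section StableFam.
Variable X : finType.
Implicit Types (A B D H : {set {set X}}) (F G P Q R S V W e : {set X}) (l k m n : nat) (x y v c : X).

Definition nontrivial H := forall c, exists2 F, F \in H & c \notin F.
(** The case [p = q] is included, so a family without a cover has no common point either. *)
Definition nocover H := forall p q, exists2 F, F \in H & (p \notin F) && (q \notin F).

Lemma del_link_cross A B v : cross A B -> cross (del A v) (link B v).
Proof. by move=> AB F R FA RB; rewrite setIC; apply: (link_hits AB FA). Qed.

Lemma nontrivial_dec H : nontrivial H \/ exists c, {in H, forall F, c \in F}.
Proof.
have [/existsP[c /forall_inP cH]|no] := boolP [exists c, [forall F in H, c \in F]].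
  by right; exists c.
left=> c; move: no; rewrite negb_exists => /forallP/(_ c).
by case/forall_inPn=> F FH cF; exists F.
Qed.

Lemma card_centered H c : {in H, forall F, c \in F} -> #|H| = #|link H c|.
Proof.
move=> cH; rewrite (card_del_link H c); suff -> : del H c = set0 by rewrite cards0.
by apply/setP => F; rewrite in_set0; apply/negP => /delP[/cH ->].
Qed.

(** Besides [c], the second set avoids a point of the first, and the third avoids a common point of
    the first two. *)
Lemma nocover_card3 H c : nocover H -> cross H H -> 3 <= #|del H c|.
Proof.
move=> nH HH; have [F1 H1 /andP[c1 _]] := nH c c.
(* Crossing a member with itself only says that it is nonempty. *)
have [e e1 _] := cross_mem HH H1 H1.
have [F2 H2 /andP[c2 e2]] := nH c e.
have [f f1 f2] := cross_mem HH H1 H2.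
have [F3 H3 /andP[c3 f3]] := nH c f.
apply/card_gt2P; exists F1, F2, F3; split.
  by split; apply/delP.
split; first by apply: contra e2 => /eqP <-.
  by apply: contra f3 => /eqP <-.
by apply: contra f3 => /eqP ->.
Qed.

Lemma stable_del_nontrivial V H v l : stable V H -> maxof V v -> H \subset ksub V l ->
  l.+1 < #|V| -> nontrivial H -> nontrivial (del H v).
Proof.
move=> sH vmax HV lt nH c; have [F FH cF] := nH c.
have [||G GH] := @stable_avoid _ V H v F [set c] l sH vmax HV FH.
- by rewrite disjoint_sym disjoints1.
- by rewrite cards1 addn1.
by rewrite disjoint_sym disjoints1; exists G.
Qed.

Lemma stable_del_nocover V H v l : stable V H -> maxof V v -> H \subset ksub V l ->
  l.+2 < #|V| -> nocover H -> nocover (del H v).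
Proof.
move=> sH vmax HV lt nH p q; have [F FH /andP[pF qF]] := nH p q.
have E G : [disjoint G & [set p; q]] = (p \notin G) && (q \notin G).
  by rewrite disjoint_sym disjoints_subset subUset !sub1set !inE.
have [||G GH] := @stable_avoid _ V H v F [set p; q] l sH vmax HV FH.
- by rewrite E pF qF.
- by rewrite (leq_ltn_trans _ lt) // -addn2 leq_add2l cards2; case: (_ != _).
by rewrite E; exists G.
Qed.

Lemma nocover_pairs_empty B D V : cross B D -> D \subset ksub V 2 -> nocover B -> D = set0.
Proof.
move=> BD DV nB; apply/setP => Q; rewrite in_set0; apply/negP => QD.
have [_ /eqP/cards2P[p [q [_ EQ]]]] := ksubP _ _ _ (subsetP DV _ QD).
have [F FB /andP[pF qF]] := nB p q.
have [z zF] := cross_mem BD FB QD; rewrite EQ => /set2P[E|E]; subst z.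
  by rewrite zF in pF.
by rewrite zF in qF.
Qed.

Lemma no_nontrivial1 V H : H \subset ksub V 1 -> cross H H -> nontrivial H -> V = set0.
Proof.
move=> HV HH nH; apply/setP => c; rewrite in_set0; apply/negP => _.
have [F FH _] := nH c; have [_ /eqP/cards1P[a EF]] := ksubP _ _ _ (subsetP HV _ FH).
have [G GH aG] := nH a; have [z] := cross_mem HH FH GH.
by rewrite EF => /set1P ->; rewrite (negPf aG).
Qed.

(** The Hilton-Milner theorem for shifted families. The link is either nontrivial, and induction
    applies one rank lower, or it has a common point [c] and can be linked once more at [c]. *)
Lemma HM_stable k V H : stable V H -> H \subset ksub V k.+2 -> cross H H -> nontrivial H ->
  2 * k.+2 <= #|V| -> #|H| + 'C(#|V| - k.+2 - 1, k.+1) <= 'C(#|V| - 1, k.+1) + 1.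
Proof.
have [m cV] : exists m, #|V| = m by exists #|V|.
elim: m k V H cV => [|m IH] k V H cV sH HV HH nH le; rewrite cV in le *; first by lia.
have [v vmax] : exists v, maxof V v by apply: maxof_ex; rewrite cV.
have vV : v \in V by case: vmax.
have cW := card_D1 vV cV.
have [E|lt] := eqVneq m.+1 (2 * k.+2).
  (* Crossed with itself, [H] has at most half of all sets, and ['C(2r, r)] is twice
     ['C(2r - 1, r - 1)]. *)
  have := @cross_compl _ H H V k.+2 HV HV HH; rewrite cV E => /(_ erefl).
  have -> : 2 * k.+2 - k.+2 - 1 = k.+1 by lia.
  rewrite binn bin_pred; last by lia.
  have -> : 'C(2 * k.+2 - 1, k.+2) = 'C(2 * k.+2 - 1, k.+1).
    by rewrite -bin_sub; [congr ('C(_, _))|]; lia.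
  lia.
have le' : 2 * k.+2 <= m by lia.
have nd : nontrivial (del H v).
  by apply: (stable_del_nontrivial sH vmax HV) => //; rewrite cV; lia.
have dHH : cross (del H v) (del H v) by apply: cross_sub HH; apply: sub_del.
have := IH k _ _ cW (stable_del sH) (del_sub v HV) dHH nd; rewrite cW => /(_ le').
have lHH : cross (link H v) (link H v).
  by apply: (stable_link_cross sH vmax HV HV HH); rewrite cV.
rewrite (card_del_link H v) [m.+1 - 1]subn1 /=.
have -> : m.+1 - k.+2 - 1 = m - k.+2 by lia.
rewrite (@bin_pred (m - k.+2)) ?[in 'C(m, _)]bin_pred; [|lia..].
set L := #|link H v|; suff : L + 'C(m - k.+2 - 1, k) <= 'C(m - 1, k) by lia.
rewrite {}/L.
have [l0|l0] := posnP #|link H v|; first by rewrite l0 add0n leq_bin2l //; lia.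
have [nl|[c cl]] := nontrivial_dec (link H v); last first.
  case/card_gt0P: l0 => Q Ql.
  have cW' : c \in V :\ v.
    by have [QV _] := ksubP _ _ _ (subsetP (link_sub v HV) _ Ql); apply: (subsetP QV); apply: cl.
  (* After removal of [c], the link still meets this member, which avoids both [v] and [c]. *)
  have d0 : 0 < #|del (del H v) c|.
    by have [F FH cF] := nd c; apply/card_gt0P; exists F; apply/delP.
  have := link_card_hits (del_link_cross HH) (del_sub v HV) (link_sub v HV) d0.
  rewrite -card_centered // (@card_D1 _ _ _ (m - 1)) //; last by rewrite cW; lia.
  by have -> : m - 1 - k.+2 = m - k.+2 - 1 by lia.
case: k IH {lt} le le' HV {nd} l0 => [|k] IH le le' HV l0.
  by have := no_nontrivial1 (link_sub v HV) lHH nl => /eqP; rewrite -cards_eq0 cW; lia.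
have := IH k _ _ cW (stable_link sH) (link_sub v HV) lHH nl.
rewrite cW (@bin_pred (m - k.+2 - 1)); last by lia.
have -> : m - k.+2 - 1 - 1 = m - k.+3 - 1 by lia.
have : 0 < 'C(m - k.+3 - 1, k) by rewrite bin_gt0; lia.
have le2 : 2 * k.+2 <= m by lia.
by move=> h /(_ le2); lia.
Qed.

(** The boolean summand makes the bound strict except at [#|V| = 2 * k.+3], where both subtracted
    binomials are 1 and the bound is exactly half of all sets. The weak case is needed to start the
    induction. *)
Lemma main_stable k V H : stable V H -> H \subset ksub V k.+3 -> cross H H -> nocover H ->
  2 * k.+3 <= #|V| ->
  #|H| + 'C(#|V| - k.+3 - 1, k.+2) + 'C(#|V| - k.+3 - 2, k.+1) + (2 * k.+3 < #|V|)
  <= 'C(#|V| - 1, k.+2) + 2.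
Proof.
have [m cV] : exists m, #|V| = m by exists #|V|.
elim: m V H cV => [|m IH] V H cV sH HV HH nH le; rewrite cV in le *; first by lia.
have [v vmax] : exists v, maxof V v by apply: maxof_ex; rewrite cV.
have vV : v \in V by case: vmax.
have cW := card_D1 vV cV.
have [E|lt] := eqVneq m.+1 (2 * k.+3).
  have := @cross_compl _ H H V k.+3 HV HV HH; rewrite cV E => /(_ erefl).
  have -> : 2 * k.+3 - k.+3 - 1 = k.+2 by lia.
  have -> : 2 * k.+3 - k.+3 - 2 = k.+1 by lia.
  rewrite ltnn !binn bin_pred; last by lia.
  have -> : 'C(2 * k.+3 - 1, k.+3) = 'C(2 * k.+3 - 1, k.+2).
    by rewrite -bin_sub; [congr ('C(_, _))|]; lia.
  lia.
have le' : 2 * k.+3 <= m by lia.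
have nd : nocover (del H v).
  by apply: (stable_del_nocover sH vmax HV) => //; rewrite cV; lia.
have dHH : cross (del H v) (del H v) by apply: cross_sub HH; apply: sub_del.
have := IH _ _ cW (stable_del sH) (del_sub v HV) dHH nd; rewrite cW => /(_ le').
have lHH : cross (link H v) (link H v).
  by apply: (stable_link_cross sH vmax HV HV HH); rewrite cV.
have dl : cross (del H v) (link H v) by apply: del_link_cross.
rewrite (card_del_link H v) [m.+1 - 1]subn1 /=.
have -> : m.+1 - k.+3 - 2 = m - k.+3 - 1 by lia.
have -> : m.+1 - k.+3 - 1 = m - k.+3 by lia.
rewrite (@bin_pred (m - k.+3 - 1) k) ?(@bin_pred (m - k.+3)) ?[in 'C(m, _)]bin_pred; [|lia..].
have -> : m - k.+3 - 1 - 1 = m - k.+3 - 2 by lia.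
set L := #|link H v|; suff : L + 'C(m - k.+3 - 1, k.+1) + 'C(m - k.+3 - 2, k) < 'C(m - 1, k.+1) by lia.
rewrite {}/L.
(* For triples the link consists of pairs, and a pair meeting every member of the deletion would be
   a cover, so the link is empty. *)
case: k IH {lt} le le' HV => [|k] IH le le' HV.
  rewrite (nocover_pairs_empty dl (link_sub v HV) nd) cards0 !bin1 bin0; lia.
have [nl|[c cl]] := nontrivial_dec (link H v); last first.
  have [l0|] := posnP #|link H v|.
    rewrite l0 [in 'C(m - 1, _)]bin_pred; last by lia.
    have le1 : m - k.+4 - 1 <= m - 1 - 1 by lia.
    have le2 : m - k.+4 - 2 <= m - 1 - 1 - 1 by lia.
    have := leq_bin2l k.+2 le1; have := leq_bin2l k.+1 le2.
    rewrite [in 'C(m - 1 - 1, k.+1)]bin_pred; last by lia.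
    have : 0 < 'C(m - 1 - 1 - 1, k) by rewrite bin_gt0; lia.
    lia.
  case/card_gt0P=> Q Ql.
  have cW' : c \in V :\ v.
    by have [QV _] := ksubP _ _ _ (subsetP (link_sub v HV) _ Ql); apply: (subsetP QV); apply: cl.
  have cW2 : #|V :\ v :\ c| = m - 1 by apply: card_D1 => //; rewrite cW; lia.
  have := link_three_hits dl (del_sub v HV) (link_sub v HV) (nocover_card3 c nd dHH).
  rewrite cW2 -card_centered //.
  have -> : m - 1 - k.+4 = m - k.+4 - 1 by lia.
  have -> : m - k.+4 - 1 - 1 = m - k.+4 - 2 by lia.
  by apply; lia.
have := HM_stable (stable_link sH) (link_sub v HV) lHH nl; rewrite cW.
case: k IH le le' HV => [|k] IH le le' HV => [_|].
  (* In rank 4 the Hilton-Milner bound for the link on [V :\ v] is one too weak. No link member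
     contains the next point [w] either, as the pair left over would be a cover, so the bound
     applies on one point fewer. *)
  have [w wmax] : exists w, maxof (V :\ v) w by apply: maxof_ex; rewrite cW; lia.
  have wW : w \in V :\ v by case: wmax.
  have cW2 : #|V :\ v :\ w| = m - 1 by apply: card_D1 => //; rewrite cW; lia.
  have ndd : nocover (del (del H v) w).
    by apply: (stable_del_nocover (stable_del sH) wmax (del_sub v HV)) => //; rewrite cW; lia.
  have l0 : link (link H v) w = set0.
    exact: (nocover_pairs_empty (del_link_cross dl) (link_sub w (link_sub v HV)) ndd).
  have E : del (link H v) w = link H v.
    apply/eqP; rewrite eqEcard sub_del (card_del_link (link H v) w) l0 cards0 addn0 //=.
  have := HM_stable (stable_del (v := w) (stable_link (v := v) sH)) (del_sub w (link_sub v HV)).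
  rewrite E cW2 => /(_ lHH nl) h; have le3 : 2 * 3 <= m - 1 by lia.
  have := h le3; rewrite [in 'C(m - 1, _)]bin_pred; last by lia.
  have -> : m - 1 - 3 - 1 = m - 4 - 1 by lia.
  rewrite !bin1; lia.
have le2 : 2 * k.+4 <= m by lia.
move=> /(_ le2); rewrite (@bin_pred (m - k.+4 - 1)); last by lia.
have -> : m - k.+4 - 1 - 1 = m - k.+4 - 2 by lia.
rewrite (@bin_pred (m - k.+4 - 2) k.+1); last by lia.
have -> : m - k.+4 - 2 - 1 = m - k.+4 - 3 by lia.
have -> : m - k.+1.+4 - 1 = m - k.+4 - 2 by lia.
have -> : m - k.+1.+4 - 2 = m - k.+4 - 3 by lia.
have le3 : k.+2 <= m - k.+4 - 3 by lia.
have := leq_bin2l k.+1 le3; rewrite binSn; lia.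
Qed.

End StableFam.

(** * Equality for cross-intersecting families of triples *)

Section Triples.
Variable X : finType.
Implicit Types (A B D H : {set {set X}}) (F G P Q R S V W e : {set X}) (l k m n : nat) (x y v c z : X).

Lemma bin_recs m : 4 <= m -> 'C(m, 2) = 'C(m - 1, 2) + (m - 1) /\
  'C(m - 1, 2) = 'C(m - 2, 2) + (m - 2) /\ 'C(m - 2, 2) = 'C(m - 3, 2) + (m - 3).
Proof.
have h j : 0 < j -> 'C(j, 2) = 'C(j - 1, 2) + (j - 1) by move=> j0; rewrite bin_pred // bin1.
move=> le; split; first by apply: h; lia.
by split; rewrite h -?subnDA //; lia.
Qed.

Lemma pair_hit2 V A B : A \subset ksub V 2 -> B \subset ksub V 2 -> cross A B ->
  4 <= #|V| -> 2 <= #|A| -> #|B| <= #|V|.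
Proof.
move=> AV BV AB V4 /card_gt1P[P1 [P2 [P1A P2A n12]]].
have hB P : P \in A -> hits B P.
  by move=> PA Q QB; rewrite setIC; apply: AB.
have := two_hits BV (hB _ P1A) (hB _ P2A) (subsetP AV _ P1A) (subsetP AV _ P2A) n12.
have [-> [-> _]] := bin_recs V4; rewrite bin1; lia.
Qed.

(** Four edges against three force a common star; what is left is a side with exactly two edges, or
    three against three. *)
Lemma graph_size V A B : A \subset ksub V 2 -> B \subset ksub V 2 -> cross A B ->
  4 <= #|V| -> 2 <= #|A| -> 2 <= #|B| ->
  [\/ exists a, {in A :|: B, forall F, a \in F},
      #|A| + #|B| <= #|V| + 2 /\ (#|A| = 2 \/ #|B| = 2) | #|A| + #|B| <= 6].
Proof.
move=> AV BV AB V4 A2 B2.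
have hA := pair_hit2 BV AV (crossC AB) V4 B2; have hB := pair_hit2 AV BV AB V4 A2.
have [EA|nA] := eqVneq #|A| 2; first by constructor 2; lia.
have [EB|nB] := eqVneq #|B| 2; first by constructor 2; lia.
have [B4|B3] := ltnP 3 #|B|.
  by constructor 1; apply: (graph_cross AV BV AB) => //; lia.
have [A4|A3] := ltnP 3 #|A|; last by constructor 3; lia.
constructor 1; have [||a ha] := graph_cross BV AV (crossC AB); [lia..|].
by exists a; rewrite setUC.
Qed.

Definition centered A B := exists v, {in A :|: B, forall F, v \in F}.
Definition edge_type A B := exists e : {set X},
  [/\ #|e| = 2, {in A, forall F, e \subset F} & hits B e].
Definition special A B := [\/ centered A B, edge_type A B | edge_type B A].

(* Equality in [cross_ge2] for triples; the two special types become [G_2] and [G_3] when [k = 4]. *)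
Definition tight V A B := #|A| + #|B| + 'C(#|V| - 3, 3) + 'C(#|V| - 3 - 1, 2) = 'C(#|V|, 3) + 2.

Lemma tightC V A B : tight V A B -> tight V B A.
Proof. by rewrite /tight (addnC #|A|). Qed.

(** Meeting all sets [{v, c, z}] without [v] and [c], the set [F] would contain every other point of
    [V]. *)
Lemma star_spread V A B v c F k : cross A B -> A \subset ksub V k -> k + 2 < #|V| ->
  F \in A -> v \notin F -> c \notin F ->
  (forall z, z \in V -> z != v -> z != c -> [set c; z] \in link B v) -> False.
Proof.
move=> AB AV lt FA vF cF h; have [_ cardF] := ksubP _ _ _ (subsetP AV _ FA).
have sub : V :\ v :\ c \subset F.
  apply/subsetP=> z /setD1P[zc /setD1P[zv zV]].
  have FA' : F \in del A v by apply/delP.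
  have [t tF] := cross_mem (del_link_cross AB) FA' (h z zV zv zc).
  by case/set2P=> E; rewrite E ?(negPf cF) // in tF *; rewrite -E.
have := subset_leq_card sub; rewrite cardF; move: lt.
rewrite (cardsD1 v V) (cardsD1 c (V :\ v)); case: (_ \in _); case: (_ \in _); lia.
Qed.

(** A set still missing could be added without violating [card_hits]. *)
Lemma hits_full D W q P : D \subset ksub W q -> hits D P ->
  'C(#|W|, q) <= #|D| + 'C(#|W :\: P|, q) ->
  forall Q, Q \in ksub W q -> Q :&: P != set0 -> Q \in D.
Proof.
move=> DW hD le Q QW QP; apply/negPn/negP => nQ.
have DQ : Q |: D \subset ksub W q by rewrite subUset sub1set QW.
have hDQ : hits (Q |: D) P by move=> R /setU1P[->|/hD].
by have := card_hits DQ hDQ; rewrite cardsU1 nQ; lia.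
Qed.

Lemma centered_card V D c q : D \subset ksub V q.+1 -> {in D, forall F, c \in F} ->
  c \in V -> #|D| <= 'C(#|V| - 1, q).
Proof.
move=> DV cD cV; rewrite (card_centered cD); apply: leq_trans (subset_leq_card (link_sub c DV)) _.
by rewrite card_ksub (cardsD1 c V) cV add1n subn1.
Qed.

Lemma centered_full V D c q : D \subset ksub V q.+1 -> {in D, forall F, c \in F} ->
  c \in V -> 'C(#|V| - 1, q) <= #|D| ->
  forall F, F \in ksub V q.+1 -> c \in F -> F \in D.
Proof.
move=> DV cD cV le F FV cF; apply/negPn/negP => nF.
have FDV : F |: D \subset ksub V q.+1 by rewrite subUset sub1set FV.
have cFD : {in F |: D, forall G, c \in G} by move=> G /setU1P[->|/cD].
by have := centered_card FDV cFD cV; rewrite cardsU1 nF; lia.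
Qed.

Lemma setD1_ksub V F v q : F \in ksub V q.+1 -> v \in F -> F :\ v \in ksub (V :\ v) q.
Proof.
case/ksubP=> FV cF vF; apply/ksubP; rewrite setSD //; split=> //.
by rewrite (cardsD1 v) vF in cF; case: cF.
Qed.

Lemma mem_link A v F : v \in F -> F \in A -> F :\ v \in link A v.
Proof. by move=> vF FA; apply/linkP; rewrite setD1K // !inE eqxx. Qed.

Section StableTight.
Variables (V : {set X}) (v : X) (A B : {set {set X}}).
Hypotheses (AV : A \subset ksub V 3) (BV : B \subset ksub V 3) (AB : cross A B).
Hypotheses (vV : v \in V) (V7 : 7 <= #|V|).
Let w := #|V :\ v|.
Hypothesis lAB : cross (link A v) (link B v).

Lemma Vw : #|V| = w.+1.
Proof. by rewrite (cardsD1 v V) vV. Qed.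

(** Exactly [2 * w - 3] pairs meet the single edge [e], so the link of [B] contains them all. In
    particular it has the full star at each point of [e], and [star_spread] puts that point into
    every member of [A]. *)
Lemma link_single : #|link A v| = 1 -> 2 * w - 2 <= #|link A v| + #|link B v| -> edge_type A B.
Proof.
have w6 : 6 <= w by move: V7; rewrite Vw.
move=> /[dup] A1 /eqP/cards1P[e Ee] le; rewrite A1 in le.
have eA : e \in link A v by rewrite Ee set11.
have [eV ce] := ksubP _ _ _ (subsetP (link_sub v AV) _ eA).
have lBV := link_sub v BV.
have hB : hits (link B v) e by move=> Q QB; rewrite setIC; apply: lAB.
have full : forall Q, Q \in ksub (V :\ v) 2 -> Q :&: e != set0 -> Q \in link B v.
  apply: (hits_full lBV hB); rewrite [#|_ :\: e|]cardsD (setIidPr eV) ce -/w.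
  have w4 : 4 <= w by lia.
  have [-> [-> _]] := bin_recs w4; lia.
have eF : {in A, forall F, e \subset F}.
  move=> F FA; have [vF|vF] := boolP (v \in F).
    by have := mem_link vF FA; rewrite Ee => /set1P <-; apply: subsetDl.
  apply/subsetP=> c ce'; apply/negPn/negP => cF.
  apply: (star_spread AB AV (ltnW V7) FA vF cF) => // z zV zv zc.
  have cV := subsetP eV _ ce'; apply: full; last by apply/set0Pn; exists c; rewrite !inE eqxx ce'.
  apply/ksubP; rewrite cards2 eq_sym zc; split=> //.
  by rewrite subUset !sub1set cV !inE zv.
exists e; split=> // G GB; have [_ veA] := linkP _ _ _ eA.
have [z] := cross_mem AB veA GB; case/setU1P => [-> vG|ze zG]; last first.
  by apply/set0Pn; exists z; rewrite inE zG.
have [t te] := cross_mem lAB eA (mem_link vG GB).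
by rewrite inE => /andP[_ tG]; apply/set0Pn; exists t; rewrite inE tG.
Qed.

(** Since [2 * w - 2] exceeds both non-star totals of [graph_size], the links share a centre; the
    count then makes both of them full stars. *)
Lemma link_star : 2 <= #|link A v| -> 2 <= #|link B v| ->
  2 * w - 2 <= #|link A v| + #|link B v| -> centered A B.
Proof.
have w6 : 6 <= w by move: V7; rewrite Vw.
move=> A2 B2 le; have [lAV lBV] := (link_sub v AV, link_sub v BV).
have w4 : 4 <= #|V :\ v| by rewrite -/w; lia.
case: (graph_size lAV lBV lAB w4 A2 B2) => [[a ha]|[]|]; [|rewrite -/w; lia..].
have aA : {in link A v, forall F, a \in F} by move=> F FA; apply: ha; rewrite inE FA.
have aB : {in link B v, forall F, a \in F} by move=> F FB; apply: ha; rewrite inE FB orbT.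
have aV : a \in V :\ v.
  have [Q QA] : exists Q, Q \in link A v by apply/set0Pn; rewrite -card_gt0; exact: ltnW.
  by have [QV _] := ksubP _ _ _ (subsetP lAV _ QA); apply: (subsetP QV); apply: aA.
have cA := centered_card lAV aA aV; have cB := centered_card lBV aB aV.
rewrite bin1 -/w in cA cB.
have fA := centered_full lAV aA aV; have fB := centered_full lBV aB aV.
rewrite bin1 -/w in fA fB.
have aw : w - 1 <= #|link A v| by lia.
have bw : w - 1 <= #|link B v| by lia.
have av : a != v by have /setD1P[] := aV.
have inst D (fD : forall F, F \in ksub (V :\ v) 2 -> a \in F -> F \in D) z :
    z \in V -> z != v -> z != a -> [set a; z] \in D.
  move=> zV zv za; apply: fD; last by rewrite !inE eqxx.
  apply/ksubP; rewrite cards2 eq_sym za; split=> //.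
  by rewrite subUset !sub1set aV !inE zv.
exists a => F /setUP[FA|FB]; apply/negPn/negP => aF.
  have [vF|vF] := boolP (v \in F).
    by have /aA := mem_link vF FA; rewrite inE (negPf aF) andbF.
  exact: (star_spread AB AV (ltnW V7) FA vF aF (inst _ (fB bw))).
have [vF|vF] := boolP (v \in F).
  by have /aB := mem_link vF FB; rewrite inE (negPf aF) andbF.
exact: (star_spread (crossC AB) BV (ltnW V7) FB vF aF (inst _ (fA aw))).
Qed.

End StableTight.

Lemma tight_stable V A B : stable V A -> stable V B -> A \subset ksub V 3 -> B \subset ksub V 3 ->
  cross A B -> 7 <= #|V| -> 3 <= #|A| -> 3 <= #|B| -> tight V A B -> special A B.
Proof.
move=> sA sB AV BV AB V7 A3 B3.
have [v vmax] : exists v, maxof V v by apply: maxof_ex; lia.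
have vV : v \in V by case: vmax.
have cV : #|V| = #|V :\ v|.+1 by rewrite (cardsD1 v V) vV.
have dA : 3 <= #|del A v| by apply: (stable_del_card sA vmax AV) => //; lia.
have dB : 3 <= #|del B v| by apply: (stable_del_card sB vmax BV) => //; lia.
have dAB : cross (del A v) (del B v) by apply: cross_sub AB; apply: sub_del.
have lAB : cross (link A v) (link B v).
  by apply: (stable_link_cross sA vmax AV BV AB); lia.
have w6 : 2 * 3 <= #|V :\ v| by lia.
have := cross_ge2 (del_sub v AV) (del_sub v BV) dAB w6 (ltnW dA) (ltnW dB).
have hB := link_three_hits AB AV BV dA; have hA := link_three_hits (crossC AB) BV AV dB.
have hB' := hB isT (ltnW w6); have hA' := hA isT (ltnW w6); clear hA hB.
have h2 := crossHM (link_sub v AV) (link_sub v BV) lAB.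
rewrite /tight cV (card_del_link A v) (card_del_link B v) => h3.
have w4 : 4 <= #|V :\ v| by lia.
have [r1 [r2 r3]] := bin_recs w4.
move: h2 h3 hA' hB' r1 r2 r3; set w := #|V :\ v|.
have -> : w.+1 - 3 - 1 = w - 3 by lia.
have -> : w.+1 - 3 = w - 2 by lia.
have -> : w - 3 - 1 = w - 4 by lia.
have e1 : 'C(w - 2, 3) = 'C(w - 3, 3) + 'C(w - 3, 2).
  by rewrite bin_pred -?subnDA //; lia.
have e2 : 'C(w - 3, 2) = 'C(w - 4, 2) + (w - 4).
  by rewrite bin_pred ?bin1 -?subnDA //; lia.
rewrite !bin1 binS.
move=> h2 h3 hA' hB' r1 r2 r3 T.
(* This is the tight total minus the bound for the deletions. An empty link contradicts it, since
   the other link stays strictly below [2 * w - 2]. *)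
have le : 2 * w - 2 <= #|link A v| + #|link B v| by lia.
have [A0|A1] := posnP #|link A v|; first by lia.
have [B0|B1] := posnP #|link B v|; first by lia.
have [EA|nA] := eqVneq #|link A v| 1.
  by constructor 2; apply: (@link_single V v).
have [EB|nB] := eqVneq #|link B v| 1.
  by constructor 3; apply: (@link_single V v) => //; [apply: crossC.. | rewrite addnC].
by constructor 1; apply: (@link_star V v) => //; lia.
Qed.

End Triples.

(** * Undoing a shift in the equality case for triples *)

Section Unshift.
Variable X : finType.
Implicit Types (A B D H : {set {set X}}) (F G P Q R S V W e : {set X}) (l k m n : nat) (x y v c z : X).

Lemma in_shift x y A F : F \in A -> F \in shift x y A \/
  [/\ y \in F, x \notin F & swap x y F \in shift x y A].
Proof.
move=> FA; have := imset_f (shift_set x y A) FA; rewrite -/(shift x y A) /shift_set.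
by case: ifP => [/and3P[yF xF _]|_]; [right | left].
Qed.

(** Two evaluations of the tight total: as two full stars, and as all triples through an edge
    together with all triples meeting it. *)
Lemma tight_bins m : 7 <= m -> 'C(m, 3) + 2 = 'C(m - 3, 3) + 'C(m - 3 - 1, 2) + 2 * 'C(m - 1, 2)
  /\ 'C(m, 3) + (m - 2) = 'C(m - 2, 3) + 2 * 'C(m - 1, 2).
Proof.
move=> m7; have h i j : i < j -> 'C(j - i, 3) = 'C(j - i.+1, 3) + 'C(j - i.+1, 2).
  by move=> ij; rewrite bin_pred ?subn_gt0 // -subnDA addn1.
have h2 i j : i < j -> 'C(j - i, 2) = 'C(j - i.+1, 2) + (j - i.+1).
  by move=> ij; rewrite bin_pred ?subn_gt0 // bin1 -subnDA addn1.
have := h 0 m; rewrite subn0 => -> //; last by lia.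
rewrite (h 1) ?(h 2); [|lia..].
have -> : m - 3 - 1 = m - 4 by lia.
rewrite (h2 1) ?(h2 2) ?(h2 3); lia.
Qed.

Lemma card_supersets V e k : e \subset V -> #|e| <= k ->
  #|[set F in ksub V k | e \subset F]| = 'C(#|V| - #|e|, k - #|e|).
Proof.
move=> eV ek; have dR R : R \in ksub (V :\: e) (k - #|e|) -> R :&: e = set0.
  case/ksubP; rewrite subsetD => /andP[_ d] _; exact: disjoint_setI0.
have -> : [set F in ksub V k | e \subset F] =
    (fun R => R :|: e) @: ksub (V :\: e) (k - #|e|).
  apply/setP => F; rewrite inE; apply/andP/imsetP => [[/ksubP[FV cF] eF]|[R RV ->]].
    exists (F :\: e); last by rewrite -{1}(setID F e) (setIidPr eF) setUC.
    by apply/ksubP; rewrite setSD // cardsD (setIidPr eF) cF.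
  have dRe := dR R RV; case/ksubP: RV => RV cR; split; last exact: subsetUr.
  apply/ksubP; rewrite subUset eV (subset_trans RV (subsetDl _ _)); split=> //.
  by rewrite cardsU dRe cards0 subn0 cR subnK.
rewrite card_in_imset => [|R S RV SV /(congr1 (fun F => F :\: e))].
  by rewrite card_ksub cardsD (setIidPr eV).
rewrite !setDUl setDv !setU0.
by rewrite !(setDidPl _) // -setI_eq0 dR.
Qed.

Lemma edge_card V D e j : D \subset ksub V j.+1 -> #|e| = j -> e \subset V ->
  {in D, forall F, e \subset F} ->
  #|D| <= #|V| - j /\ (#|V| - j <= #|D| -> forall z, z \in V -> z \notin e -> z |: e \in D).
Proof.
move=> DV ce eV eD; pose U := [set F in ksub V j.+1 | e \subset F].
have cU : #|U| = #|V| - j by rewrite card_supersets ?ce // subSnn bin1.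
have DU : D \subset U by apply/subsetP=> F FD; rewrite inE (subsetP DV) //= eD.
split; first by rewrite -cU subset_leq_card.
move=> le z zV ze; have /eqP -> : D == U by rewrite eqEcard DU cU.
by rewrite inE subsetUr andbT; apply/ksubP; rewrite subUset sub1set zV eV cardsU1 ze ce.
Qed.

(** The count makes [A] contain every extension of [e], so a triple of [B] disjoint from [e] would
    contain all of [V :\: e]. *)
Lemma edge_hits V A B e : A \subset ksub V 3 -> B \subset ksub V 3 -> cross A B -> 7 <= #|V| ->
  #|e| = 2 -> e \subset V -> {in A, forall F, e \subset F} -> #|V| - 2 <= #|A| -> hits B e.
Proof.
move=> AV BV AB V7 ce eV eA leA G GB; apply/negP => /eqP G0.
have [_ fA] := edge_card AV ce eV eA; have [_ cG] := ksubP _ _ _ (subsetP BV _ GB).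
have : V :\: e \subset G.
  apply/subsetP=> z /setDP[zV ze]; have [t] := cross_mem AB (fA leA z zV ze) GB.
  case/setU1P=> [->//|te tG]; move/setP/(_ t): G0.
  by rewrite !inE te tG.
move/subset_leq_card; rewrite cardsD (setIidPr eV) ce cG; lia.
Qed.

Lemma edge_full V A B e : A \subset ksub V 3 -> B \subset ksub V 3 -> 7 <= #|V| -> tight V A B ->
  #|e| = 2 -> e \subset V -> {in A, forall F, e \subset F} -> hits B e ->
  #|A| = #|V| - 2 /\ forall F, F \in ksub V 3 -> F :&: e != set0 -> F \in B.
Proof.
move=> AV BV V7 T ce eV eA hB; have [cA _] := edge_card AV ce eV eA.
have cB := card_hits BV hB; rewrite cardsD (setIidPr eV) ce in cB.
have [b1 b2] := tight_bins V7; move: T; rewrite /tight => T.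
split; first by lia.
by apply: (hits_full BV hB); rewrite cardsD (setIidPr eV) ce; lia.
Qed.

Lemma edge_sub V A e : A \subset ksub V 3 -> 0 < #|A| -> {in A, forall F, e \subset F} -> e \subset V.
Proof.
move=> AV /card_gt0P[F FA] eA; have [FV _] := ksubP _ _ _ (subsetP AV _ FA).
exact: subset_trans (eA _ FA) FV.
Qed.

(** The edge [e] survives unless it contains [x] but not [y]. Then [e] is [{x, c}] and every member
    of [A] has [c] and one of [x], [y]. If all members share [x] or all share [y], a new edge
    arises. Otherwise one misses [x], one misses [y], and a pair outside both contradicts the
    fullness of the shifted [B]. *)
Lemma unshift_edge V A B x y : x != y -> x \in V -> y \in V ->
  A \subset ksub V 3 -> B \subset ksub V 3 -> cross A B -> 7 <= #|V| -> 3 <= #|A| ->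
  tight V A B -> edge_type (shift x y A) (shift x y B) -> edge_type A B.
Proof.
move=> nxy xV yV AV BV AB V7 A3 T [e [ce eA hB]].
have sAV := shift_sub xV yV AV; have sBV := shift_sub xV yV BV.
have sA3 : 3 <= #|shift x y A| by rewrite card_shift.
have sT : tight V (shift x y A) (shift x y B) by rewrite /tight !card_shift.
have eV := edge_sub sAV (ltn_trans (isT : 0 < 2) sA3) eA.
have [cA fB] := edge_full sAV sBV V7 sT ce eV eA hB.
rewrite card_shift in cA.
have [hard|easy] := boolP ((x \in e) && (y \notin e)); last first.
  exists e; split=> // [F FA|G GB].
    have [/eA//|[yF xF /eA es]] := in_shift x y FA.
    have ye : y \notin e.
      by apply/negP => /(subsetP es); rewrite swap_memR (negPf xF).
    have xe : x \notin e by apply: contra easy => ->.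
    apply/subsetP=> z ze; have := subsetP es _ ze.
    by rewrite swap_mem //; [apply: contra xe | apply: contra ye] => /eqP <-.
  have [/hB//|[yG xG /hB/set0Pn[z /setIP[zs ze]]]] := in_shift x y GB.
  have [Ez|zx] := eqVneq z x.
    subst z; apply/set0Pn; exists y; rewrite inE yG /=.
    by move: easy; rewrite ze /= negbK.
  have [Ez|zy] := eqVneq z y; first by rewrite Ez swap_memR (negPf xG) in zs.
  by apply/set0Pn; exists z; rewrite inE ze andbT -(swap_mem _ zx zy).
case/andP: hard => xe ye.
have [c Ec] : exists c, e = [set x; c].
  have [p [q [_ Epq]]] := cards2P _ (introT eqP ce).
  by move: xe; rewrite Epq => /set2P[->|->]; [exists q|exists p; rewrite setUC].
have ncx : c != x by apply: contra_eqN ce => /eqP E; rewrite Ec E setUid cards1.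
have ncy : c != y by apply: contra ye => /eqP <-; rewrite Ec !inE eqxx orbT.
have cV : c \in V by apply: (subsetP eV); rewrite Ec !inE eqxx orbT.
have AF F : F \in A -> c \in F /\ (x \in F) || (y \in F).
  move=> /(in_shift x y)[/eA es|[yF xF /eA es]].
    by split; [|rewrite (subsetP es) //]; apply: (subsetP es); rewrite Ec !inE eqxx orbT.
  split; last by rewrite yF orbT.
  by rewrite -(@swap_mem _ x y c) //; apply: (subsetP es); rewrite Ec !inE eqxx orbT.
have done_by u : u \in V -> u != c -> {in A, forall F, u \in F} -> edge_type A B.
  move=> uV nuc uA; have ce' : #|[set u; c]| = 2 by rewrite cards2 nuc.
  have eV' : [set u; c] \subset V by rewrite subUset !sub1set uV.
  have eA' : {in A, forall F, [set u; c] \subset F}.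
    by move=> F FA; rewrite subUset !sub1set uA //; case: (AF F FA).
  exists [set u; c]; split=> //; apply: (edge_hits AV BV AB V7 ce' eV' eA').
  by rewrite cA.
have [/forall_inP xA|/forall_inPn[F1 F1A xF1]] := boolP [forall F in A, x \in F].
  by apply: (done_by x) => //; rewrite eq_sym.
have [/forall_inP yA|/forall_inPn[F2 F2A yF2]] := boolP [forall F in A, y \in F].
  by apply: (done_by y) => //; rewrite eq_sym.
have [cF1 yF1] := AF F1 F1A; rewrite (negPf xF1) /= in yF1.
have [cF2 xF2] := AF F2 F2A; rewrite (negPf yF2) orbF in xF2.
have [W1 c1] := ksubP _ _ _ (subsetP AV _ F1A); have [W2 c2] := ksubP _ _ _ (subsetP AV _ F2A).
(* The two triples share [c], so their union has at most five of at least seven points. *)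
have [R RW] : exists R, R \in ksub (V :\: (F1 :|: F2)) 2.
  apply/set0Pn; rewrite -card_gt0 card_ksub bin_gt0 cardsD.
  have -> : V :&: (F1 :|: F2) = F1 :|: F2 by apply/setIidPr; rewrite subUset W1.
  rewrite cardsU c1 c2; have : 0 < #|F1 :&: F2| by apply/card_gt0P; exists c; rewrite inE cF1.
  by move: V7; clear; move: #|V| #|F1 :&: F2| => a b; lia.
have [RV cR] := ksubP _ _ _ RW; move: RV; rewrite subsetD => /andP[RV RF].
have nR z : z \in F1 :|: F2 -> z \notin R.
  by move=> zF; apply/negP => zR; move/pred0P/(_ z): RF; rewrite /= zR zF.
have xR : x \notin R by apply: nR; rewrite inE xF2 orbT.
have yR : y \notin R by apply: nR; rewrite inE yF1.
have : x |: R \in shift x y B.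
  apply: fB; last by apply/set0Pn; exists x; rewrite !inE eqxx.
  by apply/ksubP; rewrite subUset sub1set xV RV cardsU1 xR cR.
rewrite shiftP // !inE eqxx (negPf yR) /= orbF eq_sym nxy /= => /orP[GB|GB].
  have [z zF1] := cross_mem AB F1A GB; case/setU1P=> [E|zR].
    by rewrite -E zF1 in xF1.
  by have := nR z; rewrite inE zF1 zR => /(_ isT).
have [z zF2] := cross_mem AB F2A GB.
have [Ez|zx] := eqVneq z x; first by rewrite Ez swap_memL !inE (negPf yR) eq_sym (negPf nxy).
have [Ez|zy] := eqVneq z y; first by rewrite -Ez zF2 in yF2.
rewrite swap_mem // !inE (negPf zx) /= => zR.
by have := nR z; rewrite inE zF2 zR orbT => /(_ isT).
Qed.

Lemma full_cross_empty V D D' : D' \subset ksub V 2 -> cross D D' -> 4 <= #|V| ->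
  ksub V 2 \subset D -> D' = set0.
Proof.
move=> DV DD V4 /subsetP fD; apply/setP => R; rewrite in_set0; apply/negP => RD.
have [RV cR] := ksubP _ _ _ (subsetP DV _ RD).
have [Q QW] : exists Q, Q \in ksub (V :\: R) 2.
  by apply/set0Pn; rewrite -card_gt0 card_ksub bin_gt0 cardsD (setIidPr RV) cR; lia.
have QV := subsetP (ksubS 2 (subsetDl V R)) _ QW.
have [z zQ zR] := cross_mem DD (fD _ QV) RD.
by have [/subsetP/(_ _ zQ)] := ksubP _ _ _ QW; rewrite inE zR.
Qed.

(** Only the centre [x] can be new. By tightness both shifted families are full stars, so every pair
    outside [{x, y}] extends by [x] or by [y] to a member of [A], and likewise of [B]. If one of the
    four restricted links is empty, its partner is full and empties the opposite link; otherwise two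
    Hilton-Milner bounds contradict the count. *)
Lemma unshift_centered V A B x y : x != y -> x \in V -> y \in V ->
  A \subset ksub V 3 -> B \subset ksub V 3 -> cross A B -> 7 <= #|V| ->
  tight V A B -> centered (shift x y A) (shift x y B) -> centered A B.
Proof.
move=> nxy xV yV AV BV AB V7 T [v hv].
have hvA F : F \in shift x y A -> v \in F by move=> h; apply: hv; rewrite inE h.
have hvB F : F \in shift x y B -> v \in F by move=> h; apply: hv; rewrite inE h orbT.
have [Ev|vx] := eqVneq v x; last first.
  have gen D F : (forall G, G \in shift x y D -> v \in G) -> F \in D -> v \in F.
    move=> h /(in_shift x y)[/h//|[yF xF /h]].
    have [->|vy] := eqVneq v y; first by rewrite yF.
    by rewrite swap_mem.
  by exists v => F /setUP[]; apply: gen.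
subst v; have sAV := shift_sub xV yV AV; have sBV := shift_sub xV yV BV.
have [b1 _] := tight_bins V7; move: (T); rewrite /tight => T'.
have cA := centered_card sAV hvA xV; have cB := centered_card sBV hvB xV.
have fA := centered_full sAV hvA xV; have fB := centered_full sBV hvB xV.
rewrite !card_shift in cA cB fA fB.
have kA : 'C(#|V| - 1, 2) <= #|A| by lia.
have kB : 'C(#|V| - 1, 2) <= #|B| by lia.
move/(_ kA): fA => fA; move/(_ kB): fB => fB.
pose W := V :\ x :\ y.
have cW : #|W| = #|V| - 2.
  have := cardsD1 x V; have := cardsD1 y (V :\ x).
  by rewrite !inE eq_sym nxy xV yV /W /= => -> ->; rewrite !add1n subn2.
pose L u D := [set R in ksub W 2 | u |: R \in D].
have LW u D : L u D \subset ksub W 2 by apply/subsetP=> R; rewrite inE => /andP[].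
have WP R : R \in ksub W 2 -> [/\ R \subset V, x \notin R, y \notin R & #|R| = 2].
  by case/ksubP; rewrite /W !subsetD1 => /andP[/andP[RV ->] ->].
have cov D : (forall F, F \in ksub V 3 -> x \in F -> F \in shift x y D) ->
    ksub W 2 \subset L x D :|: L y D.
  move=> fD; apply/subsetP=> R RW; have [RV xR yR cR] := WP R RW.
  have : x |: R \in shift x y D.
    apply: fD; last by rewrite !inE eqxx.
    by apply/ksubP; rewrite subUset sub1set xV RV cardsU1 xR cR.
  rewrite shiftP // !inE eqxx (negPf yR) /= orbF eq_sym nxy /= => /orP[->|h].
    by move: RW; rewrite inE => ->.
  have E : swap x y (x |: R) = y |: R.
    apply/setP => z; have [->|zx] := eqVneq z x.
      by rewrite swap_memL !inE (negPf yR) (negPf xR) eq_sym (negPf nxy).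
    have [->|zy] := eqVneq z y; first by rewrite swap_memR !inE !eqxx.
    by rewrite swap_mem // !inE (negPf zx) (negPf zy).
  by rewrite -E h; move: RW; rewrite inE => ->; rewrite orbT.
have crossL D D' : cross D D' -> cross (L x D) (L y D').
  move=> DD R Q; rewrite inE => /andP[/WP[_ xR yR _] RD]; rewrite inE => /andP[/WP[_ xQ yQ _] QD].
  have [z] := cross_mem DD RD QD; case/setU1P => [->|zR]; case/setU1P => [E|zQ].
  - by rewrite E eqxx in nxy.
  - by rewrite zQ in xQ.
  - by rewrite -E zR in yR.
  by apply/set0Pn; exists z; rewrite inE zR.
have xy := crossL _ _ AB; have yx := crossC (crossL _ _ (crossC AB)).
have W4 : 4 <= #|W| by move: V7; rewrite cW; clear; lia.
have all_in u u' D : u \in V -> [set u; u'] = [set x; y] -> L u' D = set0 ->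
    D \subset ksub V 3 -> (forall F, F \in D -> (x \in F) || (y \in F)) -> {in D, forall F, u \in F}.
  move=> uV Euu L0 DV xyD F FD; apply/negPn/negP => uF.
  have u'F : u' \in F.
    have : (u \in F) || (u' \in F).
      have [z zF] : exists2 z, z \in F & z \in [set x; y].
        by case/orP: (xyD F FD) => h; [exists x|exists y]; rewrite // !inE eqxx ?orbT.
      by rewrite -Euu => /set2P[E|E]; rewrite -E zF ?orbT.
    by rewrite (negPf uF).
  have : F :\ u' \in L u' D.
    rewrite inE setD1K // FD andbT; have [FV cF] := ksubP _ _ _ (subsetP DV _ FD).
    have W' : W = V :\ u :\ u'.
      have -> : W = V :\: [set x; y] by apply/setP => z; rewrite !inE negb_or; case: (z == x) => //=; case: (z == y).
      by rewrite -Euu; apply/setP => z; rewrite !inE negb_or; case: (z == u) => //=; case: (z == u').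
    rewrite W'; apply: setD1_ksub => //; apply/ksubP; split=> //.
    by rewrite subsetD1 FV.
  by rewrite L0 in_set0.
have orA F : F \in A -> (x \in F) || (y \in F).
  by move=> /(in_shift x y)[/hvA ->//|[-> _ _]]; rewrite orbT.
have orB F : F \in B -> (x \in F) || (y \in F).
  by move=> /(in_shift x y)[/hvB ->//|[-> _ _]]; rewrite orbT.
have fin u u' : u \in V -> [set u; u'] = [set x; y] -> L u' A = set0 -> L u' B = set0 ->
    centered A B.
  move=> uV E LA LB; exists u => F /setUP[FA|FB].
    exact: (all_in u u' A).
  exact: (all_in u u' B).
have cvA := cov _ fA; have cvB := cov _ fB.
have Eyx : [set y; x] = [set x; y] by rewrite setUC.
have [yA|yA] := eqVneq (L y A) set0.
  rewrite yA setU0 in cvA; apply: (fin x y) => //.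
  exact: (full_cross_empty (LW y B) xy W4 cvA).
have [xA|xA] := eqVneq (L x A) set0.
  rewrite xA set0U in cvA; apply: (fin y x) => //.
  exact: (full_cross_empty (LW x B) yx W4 cvA).
have [yB|yB] := eqVneq (L y B) set0.
  rewrite yB setU0 in cvB; apply: (fin x y) => //.
  exact: (full_cross_empty (LW y A) (crossC yx) W4 cvB).
have [xB|xB] := eqVneq (L x B) set0.
  rewrite xB set0U in cvB; apply: (fin y x) => //.
  exact: (full_cross_empty (LW x A) (crossC xy) W4 cvB).
rewrite -!card_gt0 in yA xA yB xB.
have h1 := crossHM (LW x A) (LW y B) xy W4 xA yB.
have h2 := crossHM (LW y A) (LW x B) yx W4 yA xB.
have h3 := leq_trans (subset_leq_card cvA) (leq_card_setU _ _).1.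
have h4 := leq_trans (subset_leq_card cvB) (leq_card_setU _ _).1.
(* Each Hilton-Milner bound falls below the number of pairs as soon as the subtracted binomial
   exceeds 1. *)
rewrite card_ksub in h3 h4; have : 3 <= #|W| - 2 by move: V7; rewrite cW; clear; lia.
move/(leq_bin2l 2); rewrite (_ : 'C(3, 2) = 3) //.
move: h1 h2 h3 h4; clear; lia.
Qed.

Lemma tight_special V A B : A \subset ksub V 3 -> B \subset ksub V 3 -> cross A B ->
  7 <= #|V| -> 3 <= #|A| -> 3 <= #|B| -> tight V A B -> special A B.
Proof.
pattern A, B; apply: (@shift_ind _ V) => {}A {}B.
  by move=> sA sB; apply: tight_stable.
move=> x y xV yV lt IH AV BV AB V7 A3 B3 T.
have nxy : x != y by apply: contraTN lt => /eqP ->; rewrite ltnn.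
have := IH (shift_sub xV yV AV) (shift_sub xV yV BV) (shift_cross (x:=x) (y:=y) AB) V7.
rewrite /tight !card_shift => /(_ A3 B3 T)[h|h|h].
- by constructor 1; apply: (unshift_centered nxy xV yV AV BV AB).
- by constructor 2; apply: (unshift_edge nxy xV yV AV BV AB).
- by constructor 3; apply: (unshift_edge nxy xV yV BV AV (crossC AB) V7 B3 (tightC T)).
Qed.

End Unshift.

(** * Families nearly covered by two points *)

Section Main.
Variable X : finType.
Implicit Types (A B D H : {set {set X}}) (F G P Q R S V W e : {set X}) (l k m n : nat) (x y v c z p q : X).

(** Members are sorted by their trace on [{x, y}] and stripped of it, so that all classes live on
    [outside x y]. *)
Definition none H x y := del (del H x) y.
Definition side H x y := del (link H x) y.
Definition both H x y := link (link H x) y.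
Definition outside x y : {set X} := ~: [set x; y].

Lemma noneP H x y F : reflect [/\ F \in H, x \notin F & y \notin F] (F \in none H x y).
Proof. by apply: (iffP (delP _ _ _)) => [[/delP[]]|[FH xF yF]] //; split=> //; apply/delP. Qed.

Lemma sideP H x y R : reflect [/\ x |: R \in H, x \notin R & y \notin R] (R \in side H x y).
Proof. by apply: (iffP (delP _ _ _)) => [[/linkP[]]|[FH xF yF]] //; split=> //; apply/linkP. Qed.

Lemma bothP H x y R : x != y ->
  reflect [/\ x |: (y |: R) \in H, x \notin R & y \notin R] (R \in both H x y).
Proof.
move=> nxy; apply: (iffP (linkP _ _ _)) => [[yR /linkP[]]|[RH xR yR]].
  by rewrite !inE negb_or => /andP[].
by split=> //; apply/linkP; rewrite !inE negb_or nxy.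
Qed.

Lemma noneC H x y : none H x y = none H y x.
Proof. by apply/setP => F; apply/noneP/noneP; case. Qed.

Lemma outsideC x y : outside x y = outside y x.
Proof. by rewrite /outside setUC. Qed.

Lemma sub_outside x y R : (R \subset outside x y) = (x \notin R) && (y \notin R).
Proof. by rewrite /outside subsetC subUset !sub1set !inE. Qed.

Lemma card_outside x y : x != y -> #|outside x y| = #|X| - 2.
Proof. by move=> nxy; rewrite /outside cardsCs setCK cards2 nxy. Qed.

Lemma ksubT k F : (F \in ksub [set: X] k) = (#|F| == k).
Proof. by rewrite inE subsetT. Qed.

Lemma card_delC H x y : x != y -> #|del H y| = #|none H x y| + #|side H x y|.
Proof.
move=> nxy; rewrite (card_del_link (del H y) x) noneC; congr (_ + _).
apply: eq_card => R; apply/linkP/sideP => [[xR /delP[RH]]|[RH xR yR]].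
  by rewrite !inE negb_or => /andP[].
by split=> //; apply/delP; rewrite !inE negb_or eq_sym nxy.
Qed.

Lemma card_four H x y : x != y ->
  #|H| = #|none H x y| + #|side H x y| + #|side H y x| + #|both H x y|.
Proof.
move=> nxy; rewrite (card_del_link H x) (card_delC H (x := y)) 1?eq_sym // noneC.
rewrite (card_del_link (link H x) y) -/(side H x y) -/(both H x y); lia.
Qed.

Lemma none_sub H x y k : H \subset ksub [set: X] k -> none H x y \subset ksub (outside x y) k.
Proof.
move=> /subsetP HV; apply/subsetP=> F /noneP[/HV]; rewrite ksubT => /eqP cF xF yF.
by apply/ksubP; rewrite sub_outside xF.
Qed.

Lemma side_sub H x y k : H \subset ksub [set: X] k.+1 -> side H x y \subset ksub (outside x y) k.
Proof.
move=> /subsetP HV; apply/subsetP=> R /sideP[/HV]; rewrite ksubT => /eqP cF xF yF.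
by apply/ksubP; rewrite sub_outside xF; rewrite cardsU1 xF in cF; case: cF.
Qed.

Lemma both_sub H x y k : x != y -> H \subset ksub [set: X] k.+2 -> both H x y \subset ksub (outside x y) k.
Proof.
move=> nxy /subsetP HV; apply/subsetP=> R /(bothP _ _ nxy)[/HV]; rewrite ksubT => /eqP cF xF yF.
by apply/ksubP; rewrite sub_outside xF; rewrite !cardsU1 !inE negb_or nxy xF yF in cF; case: cF.
Qed.

Lemma side_cross H x y : x != y -> cross H H -> cross (side H x y) (side H y x).
Proof.
move=> nxy HH R Q /sideP[RH xR yR] /sideP[QH yQ xQ].
have [z] := cross_mem HH RH QH; case/setU1P => [->|zR]; case/setU1P => [E|zQ].
- by rewrite E eqxx in nxy.
- by rewrite zQ in xQ.
- by rewrite -E zR in yR.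
by apply/set0Pn; exists z; rewrite inE zR.
Qed.

Lemma side_hits H x y F : cross H H -> F \in none H x y -> hits (side H x y) F.
Proof.
move=> HH /noneP[FH xF yF] R /sideP[RH xR yR]; have [z zF] := cross_mem HH FH RH.
by case/setU1P => [E|zR]; [rewrite -E zF in xF | apply/set0Pn; exists z; rewrite inE zR].
Qed.

Lemma both_hits H x y F : x != y -> cross H H -> F \in none H x y -> hits (both H x y) F.
Proof.
move=> nxy HH /noneP[FH xF yF] R /(bothP _ _ nxy)[RH xR yR]; have [z zF] := cross_mem HH FH RH.
case/setU1P => [E|]; first by rewrite -E zF in xF.
by case/setU1P => [E|zR]; [rewrite -E zF in yF | apply/set0Pn; exists z; rewrite inE zR].
Qed.

Lemma side_mem H x y F : x \in F -> y \notin F -> F \in H -> F :\ x \in side H x y.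
Proof. by move=> xF yF FH; apply/sideP; split; rewrite ?setD1K ?inE ?eqxx ?(negPf yF) ?andbF. Qed.

(** Excluding [F_0] and [F_1] amounts to this: no point is missed by no member or by exactly one. *)
Definition good H := forall c, 2 <= #|del H c|.
Definition pair_cover H x y := forall F, F \in H -> (x \in F) || (y \in F).

Lemma coverC H x y : pair_cover H x y -> pair_cover H y x.
Proof. by move=> h F /h; rewrite orbC. Qed.

Lemma cover_none H x y : pair_cover H x y <-> none H x y = set0.
Proof.
split=> [h|h F FH].
  by apply/setP => F; rewrite in_set0; apply/negP => /noneP[/h/orP[->|->]].
by move/setP/(_ F): h; rewrite in_set0; apply: contraFT; rewrite negb_or => /andP[xF yF]; apply/noneP.
Qed.

Section Uniform.
Variables (k : nat).
Local Notation n := #|X|.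
Hypothesis nk : 2 * k.+3 < n.
Let m := n - 2.

(* The bound on [#|H|] is [target - loss]; sums are compared because subtraction on [nat] truncates. *)
Definition loss := 'C(n - k.+3 - 1, k.+2) + 'C(n - k.+3 - 2, k.+1).
Definition target := 'C(n - 1, k.+2) + 2.

Lemma targetE : target = 'C(m, k.+2) + 'C(m, k.+1) + 2.
Proof.
rewrite /target /m [in LHS]bin_pred; last by lia.
by have -> : n - 1 - 1 = n - 2 by lia.
Qed.

Lemma lossE : loss = 'C(m - k.+2, k.+2) + 'C(m - k.+2 - 1, k.+1).
Proof.
by rewrite /loss /m; congr ('C(_, _) + 'C(_, _)); lia.
Qed.

Definition fam H := H \subset ksub [set: X] k.+3.

Section OneFamily.
Variable H : {set {set X}}.
Hypotheses (HV : fam H) (HH : cross H H).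

Lemma both_le x y : x != y -> #|both H x y| <= 'C(m, k.+1).
Proof.
by move=> nxy; have := subset_leq_card (both_sub nxy HV); rewrite card_ksub card_outside.
Qed.

(** The members through both points are bounded trivially, those through one point as a
    cross-intersecting pair. The excluded case, graphs with a common centre, is the one that leads
    to [G_2]. *)
Lemma cover_bound x y : x != y -> good H -> pair_cover H x y ->
  ~ (k = 0 /\ centered (side H x y) (side H y x)) ->
  #|H| + loss <= target /\ (#|H| + loss = target ->
    #|side H x y| + #|side H y x| + loss = 'C(m, k.+2) + 2 /\
    [\/ #|side H x y| = 2, #|side H y x| = 2 |
        k = 1 /\ special (side H x y) (side H y x)]).
Proof.
move=> nxy gH /cover_none N0 nG2; have := gH y; have := gH x.
have nyx : y != x by rewrite eq_sym.
rewrite (card_delC H nyx) (card_delC H nxy) [none H y x]noneC N0 cards0 !add0n => B2 A2.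
have SA := side_sub x y HV; have SB := side_sub y x HV; rewrite outsideC in SB.
have AB := side_cross nxy HH.
have hb := both_le nxy; have cW := card_outside nxy; rewrite -/m in cW.
have m2 : 2 * k.+2 < #|outside x y| by rewrite cW /m; lia.
rewrite (card_four H nxy) N0 cards0 add0n targetE.
set a := #|side H x y| in A2 *; set b := #|side H y x| in B2 *.
suff [le eq] : a + b + loss <= 'C(m, k.+2) + 2 /\ (a + b + loss = 'C(m, k.+2) + 2 ->
    [\/ a = 2, b = 2 | k = 1 /\ special (side H x y) (side H y x)]).
  split; first by lia.
  move=> E; have E' : a + b + loss = 'C(m, k.+2) + 2 by lia.
  by split=> //; apply: eq.
rewrite lossE addnA -cW; subst a b.
case: k nk HV SA SB m2 nG2 => [|j] nk' HV' SA SB m2 nG2.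
  (* For triples the sides are graphs, and the estimate amounts to a total of at most
     [#|outside x y| + 2]. *)
  have W4 : 4 <= #|outside x y| by lia.
  have [e1 [e2 _]] := bin_recs W4; rewrite bin1.
  have m5 : 5 <= #|outside x y| by lia.
  case: (graph_size SA SB AB W4 A2 B2) => [ce|[le h]|le].
  - by case: nG2.
  - split; first by lia.
    by move=> _; case: h => ->; [constructor 1|constructor 2].
  - split; first by lia.
    by lia.
split; first exact: (cross_ge2 SA SB AB (ltnW m2) A2 B2).
move=> E.
have [EA|nA] := eqVneq #|side H x y| 2; first by constructor 1.
have [EB|nB] := eqVneq #|side H y x| 2; first by constructor 2.
have A3 : 3 <= #|side H x y| by rewrite ltn_neqAle eq_sym nA.
have B3 : 3 <= #|side H y x| by rewrite ltn_neqAle eq_sym nB.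
(* [j = 0] means 4-sets with triples on the sides; in higher rank three members on each side are
   strictly below the bound. *)
constructor 3; case: j nk' HV' SA SB m2 nG2 E => [|j] nk' HV' SA SB m2 nG2 E.
  by split=> //; apply: (tight_special SA SB AB).
by have := cross_ge3 SA SB AB m2 A3 B3; rewrite E ltnn.
Qed.

Lemma del2_cover c : #|del H c| = 2 -> exists e : X, [/\ e != c, pair_cover H c e &
  exists P1 P2, [/\ del H c = [set P1; P2], P1 != P2, e \in P1 & e \in P2]].
Proof.
move=> d2; have /cards2P[P1 [P2 [n12 E]]] := introT eqP d2.
have [H1 c1] : P1 \in H /\ c \notin P1 by apply/delP; rewrite E !inE eqxx.
have [H2 c2] : P2 \in H /\ c \notin P2 by apply/delP; rewrite E !inE eqxx orbT.
have [e e1 e2] := cross_mem HH H1 H2; exists e; split.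
- by apply: contra c1 => /eqP <-.
- move=> F FH; case: (boolP (c \in F)) => //= cF.
  have : F \in del H c by apply/delP.
  by rewrite E => /set2P[->|->].
by exists P1, P2.
Qed.

(** A side with a single member leaves only two members missing one of the points; they intersect,
    and this yields a cover. With two members on each side the strict Hilton-Milner bound applies,
    except for graphs with a common centre. *)
Lemma one_miss x y : x != y -> good H -> #|none H x y| = 1 ->
  #|H| + loss < target \/ exists p q : X, p != q /\ pair_cover H p q.
Proof.
move=> nxy gH N1; have nyx : y != x by rewrite eq_sym.
have := gH y; have := gH x.
rewrite (card_delC H nyx) (card_delC H nxy) [none H y x]noneC N1 !add1n !ltnS => B1 A1.
have [EA|nA] := eqVneq #|side H x y| 1.
  right; have [|e [ne ce _]] := @del2_cover y; first by rewrite (card_delC H nxy) N1 EA.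
  by exists y, e; rewrite eq_sym.
have [EB|nB] := eqVneq #|side H y x| 1.
  right; have [|e [ne ce _]] := @del2_cover x.
    by rewrite (card_delC H nyx) noneC N1 EB.
  by exists x, e; rewrite eq_sym.
have A2 : 2 <= #|side H x y| by rewrite ltn_neqAle eq_sym nA.
have B2 : 2 <= #|side H y x| by rewrite ltn_neqAle eq_sym nB.
have SA := side_sub x y HV; have SB := side_sub y x HV; rewrite outsideC in SB.
have AB := side_cross nxy HH; have cW := card_outside nxy; rewrite -/m in cW.
have m2 : 2 * k.+2 < #|outside x y| by rewrite cW /m; lia.
have [F0 EF0] := cards1P (introT eqP N1).
have F0N : F0 \in none H x y by rewrite EF0 set11.
have [F0V cF0] := ksubP _ _ _ (subsetP (none_sub x y HV) _ F0N).
have hb := card_hits (both_sub nxy HV) (both_hits nxy HH F0N).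
rewrite cardsD (setIidPr F0V) cF0 cW in hb.
(* Members through both points meet [F0], which already pays for the second binomial of [loss]; the
   sides have to pay for the first one strictly. *)
have Eb : m - k.+3 = m - k.+2 - 1 by lia.
suff : #|side H x y| + #|side H y x| + 'C(m - k.+2, k.+2) < 'C(m, k.+2) + 1 \/
    exists p q : X, p != q /\ pair_cover H p q.
  case=> [lt|h]; [left|by right].
  rewrite (card_four H nxy) N1 targetE lossE; rewrite Eb in hb; lia.
rewrite -cW {hb Eb}.
case: k nk HV SA SB m2 cF0 => [|j] nk' HV' SA SB m2 cF0; last first.
  by left; apply: crossHM_strict.
have W4 : 4 <= #|outside x y| by lia.
have [e1 [e2 _]] := bin_recs W4.
have m5 : 5 <= #|outside x y| by lia.
case: (graph_size SA SB AB W4 A2 B2) => [[a ha]|[le h]|le]; [|left; lia..].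
have ax : a != x.
  have /card_gt0P[R RA] := ltnW A2; have [_ xR _] := sideP _ _ _ _ RA.
  by apply: contra xR => /eqP <-; apply: ha; rewrite inE RA.
(* [F0] is the only member missing [x] and [y], so a common centre inside it gives the cover
   [{x, a}]. *)
have [aF0|aF0] := boolP (a \in F0).
  right; exists x, a; split; first by rewrite eq_sym.
  move=> F FH; have [//|xF] := boolP (x \in F).
  have [yF|yF] := boolP (y \in F); last first.
    have : F \in none H x y by apply/noneP.
    by rewrite EF0 => /set1P ->.
  have : a \in F :\ y by apply: ha; rewrite inE (side_mem yF xF FH) orbT.
  by rewrite inE => /andP[].
(* An edge at [a] that meets [F0] is determined by its end in [F0], which has three points. *)
left; have few D : D \subset ksub (outside x y) 2 -> hits D F0 -> {in D, forall F, a \in F} -> #|D| <= 3.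
  move=> DV hD aD; have sub : D \subset (fun z => [set a; z]) @: F0.
    apply/subsetP=> R RD; have [_ cR] := ksubP _ _ _ (subsetP DV _ RD).
    have /set0Pn[z /setIP[zR zF]] := hD R RD; apply/imsetP; exists z => //.
    have naz : a != z by apply: contra aF0 => /eqP ->.
    by apply/eqP; rewrite eq_sym eqEcard cR cards2 naz subUset !sub1set zR aD.
  by rewrite -cF0; apply: leq_trans (subset_leq_card sub) (leq_imset_card _ _).
have fA : #|side H x y| <= 3.
  by apply: few SA (side_hits HH F0N) _ => R RA; apply: ha; rewrite inE RA.
have fB : #|side H y x| <= 3.
  rewrite noneC in F0N.
  by apply: few SB (side_hits HH F0N) _ => R RB; apply: ha; rewrite inE RB orbT.
lia.
Qed.

Lemma two_side x y : x != y -> #|side H x y| = 2 ->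
  #|side H x y| + #|side H y x| + loss = 'C(m, k.+2) + 2 ->
  exists R1 R2, [/\ side H x y = [set R1; R2], R1 != R2, #|R1 :|: R2| = k.+3,
     #|R1| = k.+2 & #|R2| = k.+2].
Proof.
move=> nxy A2; have SA := side_sub x y HV; have SB := side_sub y x HV; rewrite outsideC in SB.
have AB := side_cross nxy HH; have cW := card_outside nxy; rewrite -/m in cW.
have /cards2P[R1 [R2 [n12 E]]] := introT eqP A2.
have K1 : R1 \in side H x y by rewrite E !inE eqxx.
have K2 : R2 \in side H x y by rewrite E !inE eqxx orbT.
have [_ c1] := ksubP _ _ _ (subsetP SA _ K1); have [_ c2] := ksubP _ _ _ (subsetP SA _ K2).
rewrite A2 lossE -cW => eq; exists R1, R2; split=> //.
have hB P : P \in side H x y -> hits (side H y x) P.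
  by move=> PA Q QB; rewrite setIC; apply: AB.
apply: (two_hits_eq SB (hB _ K1) (hB _ K2) (subsetP SA _ K1) (subsetP SA _ K2) n12); last by lia.
by rewrite cW /m; lia.
Qed.

End OneFamily.
End Uniform.
End Main.

(** * Families with no near cover *)

Section NoNearCover.
Variable X : finType.
Implicit Types (A B D H : {set {set X}}) (F G P Q R S V W e : {set X}) (l k m n : nat) (x y v c z p q : X).

(** A moved member contained [y] and gains only [x]. Hence a shift can reduce the number of members
    missing a pair only if that pair contains [x] but not [y]. *)
Lemma shift_none H x y p q : (x \in [set p; q] -> y \in [set p; q]) ->
  #|none H p q| <= #|none (shift x y H) p q|.
Proof.
move=> xy; have sub : shift_set x y H @: none H p q \subset none (shift x y H) p q.
  apply/subsetP=> _ /imsetP[F /noneP[FH pF qF] ->].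
  have sF : shift_set x y H F \in shift x y H by apply: imset_f.
  suff : shift_set x y H F = F \/ p \notin shift_set x y H F /\ q \notin shift_set x y H F.
    by case=> [E|[]]; [rewrite E in sF *|]; move=> *; apply/noneP.
  rewrite /shift_set; case: ifP => [/and3P[yF xF _]|]; [right|by left].
  have ny : y \notin [set p; q].
    by rewrite !inE negb_or; apply/andP; split; [apply: contra pF|apply: contra qF] => /eqP <-.
  have nx : x \notin [set p; q] by apply: contra ny.
  move: nx ny; rewrite !inE !negb_or => /andP[xp xq] /andP[yp yq].
  by split; [rewrite -/(p \notin _)|]; rewrite -?in_setC ?inE tpermD.
apply: leq_trans (subset_leq_card sub); rewrite card_in_imset // => F1 F2.
by move=> /noneP[H1 _ _] /noneP[H2 _ _]; apply: shift_set_inj.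
Qed.

Definition spread H := forall p q, p != q -> 2 <= #|none H p q|.

Lemma spread_not_cover H p q : spread H -> p != q -> pair_cover H p q -> False.
Proof. by move=> sH npq /cover_none E; have := sH p q npq; rewrite E cards0. Qed.

Lemma swap_add x y R : x \notin R -> y \notin R -> swap x y (y |: R) = x |: R.
Proof.
move=> xR yR; apply/setP => z; have [->|zx] := eqVneq z x; first by rewrite swap_memL !inE !eqxx.
have [->|zy] := eqVneq z y.
  by rewrite swap_memR !inE (negPf xR) (negPf yR) eq_sym.
by rewrite swap_mem // !inE (negPf zx) (negPf zy).
Qed.

Lemma shift_add x y H R : x != y -> x \notin R -> y \notin R ->
  (y |: R \in shift x y H) = (y |: R \in H) && (x |: R \in H).
Proof.
move=> nxy xR yR; rewrite shiftP // swap_add // !inE eqxx (negPf xR) (negPf nxy) /=.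
by [].
Qed.

Lemma cover_side H x q a : pair_cover H x q -> {in side H x q, forall R, a \in R} -> pair_cover H q a.
Proof.
move=> cH aR F FH; have [//|qF] := boolP (q \in F).
have := cH F FH; rewrite (negPf qF) orbF => xF.
by have := aR _ (side_mem xF qF FH); rewrite inE => /andP[].
Qed.

(** The single edge [P] meets itself but is not in [B], so the count of edges meeting [P] has one to
    spare. *)
Lemma graph_single V A B : A \subset ksub V 2 -> B \subset ksub V 2 -> cross A B ->
  [disjoint A & B] -> #|A| = 1 -> #|A| + #|B| + 'C(#|V| - 2, 2) < 'C(#|V|, 2) + 1.
Proof.
move=> SA SB AB dAB A1; have [P EP] := cards1P (introT eqP A1).
have PA : P \in A by rewrite EP set11.
have PB : P \notin B by apply/negP => PB; have /pred0P/(_ P) /= := dAB; rewrite PA PB.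
have [PV cP] := ksubP _ _ _ (subsetP SA _ PA).
have sub : P |: B \subset ksub V 2 by rewrite subUset sub1set (subsetP SA _ PA).
have hP : hits (P |: B) P.
  move=> Q /setU1P[->|QB]; first by rewrite setIid -card_gt0 cP.
  by rewrite setIC; apply: AB.
by have := card_hits sub hP; rewrite cardsD (setIidPr PV) cP cardsU1 PB A1 addn1 ltnS.
Qed.

Lemma graph_disjoint V A B : A \subset ksub V 2 -> B \subset ksub V 2 -> cross A B ->
  5 <= #|V| -> 0 < #|A| -> 0 < #|B| -> [disjoint A & B] ->
  #|A| + #|B| + 'C(#|V| - 2, 2) < 'C(#|V|, 2) + 1.
Proof.
move=> SA SB AB V5 A0 B0 dAB.
have [EA|nA] := eqVneq #|A| 1; first exact: graph_single.
have [EB|nB] := eqVneq #|B| 1.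
  by rewrite (addnC #|A|); apply: graph_single => //; [apply: crossC|rewrite disjoint_sym].
have A2 : 2 <= #|A| by rewrite ltn_neqAle eq_sym nA.
have B2 : 2 <= #|B| by rewrite ltn_neqAle eq_sym nB.
have [e1 [e2 _]] := bin_recs (ltnW V5).
case: (graph_size SA SB AB (ltnW V5) A2 B2) => [[a ha]|[le _]|le].
- have U : A :|: B \subset ksub V 2 by rewrite subUset SA SB.
  have aV : a \in V.
    case/card_gt0P: A0 => R RA; have [RV _] := ksubP _ _ _ (subsetP SA _ RA).
    by apply: (subsetP RV); apply: ha; rewrite inE RA.
  have := centered_card U ha aV; rewrite cardsU_disj // bin1.
  by clear -e1 e2 V5; lia.
- by clear -e1 e2 V5 le; lia.
- by clear -e1 e2 V5 le; lia.
Qed.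

Section Step.
Variables (k : nat) (H : {set {set X}}) (x y : X).
Local Notation n := #|X|.
Hypotheses (nk : 2 * k.+3 < n) (HV : fam k H) (HH : cross H H) (sH : spread H) (nxy : x != y).
Let m := n - 2.
Let Gs := shift x y H.

Let cW : #|outside x y| = m. Proof. exact: card_outside. Qed.
Let SA : side H x y \subset ksub (outside x y) k.+2. Proof. exact: side_sub. Qed.
Let SB : side H y x \subset ksub (outside x y) k.+2. Proof. by rewrite outsideC; apply: side_sub. Qed.
Let AB : cross (side H x y) (side H y x). Proof. exact: side_cross. Qed.
Let m2 : 2 * k.+2 < #|outside x y|. Proof. by rewrite cW /m; lia. Qed.

Lemma both_le2 : #|both H x y| + 'C(m - k.+3, k.+1) + 'C(m - k.+3 - 1, k) <= 'C(m, k.+1).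
Proof.
have /card_gt1P[P1 [P2 [K1 K2 n12]]] := sH nxy; have NV := subsetP (none_sub x y HV).
rewrite -cW.
exact: (two_hits (both_sub nxy HV) (both_hits nxy HH K1) (both_hits nxy HH K2) (NV _ K1) (NV _ K2)).
Qed.

(** The crude bound on the sides loses 1 and [both_le2] gains ['C(m - k.+3 - 1, k)]. For [k = 0]
    this gain is only 1, so strictness has to come from the disjointness of the sides. *)
Lemma few_none : #|none H x y| = 2 -> 0 < #|side H x y| -> 0 < #|side H y x| ->
  (k = 0 -> [disjoint side H x y & side H y x]) -> #|H| + loss X k < target X k.
Proof.
move=> N2 A0 B0 dAB; rewrite (card_four H nxy) N2 (targetE nk) (lossE nk) -/m.
have hb := both_le2; have hm := m2; rewrite cW in hm.
have -> : m - k.+2 - 1 = m - k.+3 by lia.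
have := crossHM SA SB AB (ltnW m2) A0 B0; rewrite cW => hAB.
case: k nk HV dAB hm hb hAB SA SB m2 => [|j] nk' HV' dAB hm hb hAB SA' SB' m2'; last first.
  clear -hm hb hAB; have le : j.+2 <= m - j.+4 - 1 by lia.
  have := leq_bin2l j.+1 le; rewrite binSn.
  have := @bin_pred (m - j.+3) j.+2.
  have -> : m - j.+3 - 1 = m - j.+4 by lia.
  lia.
rewrite !bin1 bin0 in hb; rewrite !bin1.
suff : #|side H x y| + #|side H y x| + 'C(m - 2, 2) < 'C(m, 2) + 1.
  by clear -hb hm; lia.
rewrite -cW; apply: graph_disjoint => //; last exact: dAB.
Qed.

(** Members missing [x] and [y] are untouched by the shift and so contain [q]; an empty side would
    make [q] and one of [x], [y] a cover of [H] itself. *)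
Lemma sides_nonempty q : q != x -> q != y -> pair_cover Gs x q ->
  0 < #|side H x y| /\ 0 < #|side H y x|.
Proof.
move=> nqx nqy cG.
have qN F : F \in H -> x \notin F -> y \notin F -> q \in F.
  move=> FH xF yF; have /cG : F \in Gs.
    by rewrite /Gs shiftP // (negPf xF) (negPf yF).
  by rewrite (negPf xF).
split; rewrite lt0n; apply/negP => /eqP/cards0_eq E.
  apply: (@spread_not_cover H y q sH); first by rewrite eq_sym.
  move=> F FH; have [//|yF] := boolP (y \in F); have [xF|xF] := boolP (x \in F); last exact: qN.
  by have := side_mem xF yF FH; rewrite E in_set0.
apply: (@spread_not_cover H x q sH); first by rewrite eq_sym.
move=> F FH; have [//|xF] := boolP (x \in F); have [yF|yF] := boolP (y \in F); last exact: qN.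
by have := side_mem yF xF FH; rewrite E in_set0.
Qed.

Let GV : fam k Gs. Proof. by apply: shift_sub. Qed.
Let GG : cross Gs Gs. Proof. exact: shift_cross. Qed.

Lemma near_cover_shift p q : p != q -> #|none Gs p q| <= 1 ->
  x \in [set p; q] /\ y \notin [set p; q].
Proof.
move=> npq le; have [/andP[]//|no] := boolP ((x \in [set p; q]) && (y \notin [set p; q])).
have h : #|none H p q| <= #|none Gs p q|.
  by apply: shift_none => xpq; move: no; rewrite xpq /= negbK.
by have := leq_trans (leq_trans (sH npq) h) le.
Qed.

Lemma cover_shift p q : p != q -> pair_cover Gs p q -> x \in [set p; q] /\ y \notin [set p; q].
Proof. by move=> npq /cover_none E; apply: near_cover_shift => //; rewrite E cards0. Qed.

Lemma no_cover_shift p q : p != q -> p != x -> q != x -> pair_cover Gs p q -> False.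
Proof.
move=> npq px qx /(cover_shift npq)[]; rewrite !inE => /orP[] /eqP E.
  by rewrite E eqxx in px.
by rewrite E eqxx in qx.
Qed.

Lemma good_shift : good Gs.
Proof.
move=> c; have [->|ncx] := eqVneq c x.
  apply: leq_trans (sH nxy) _; apply: (@leq_trans #|none Gs x y|).
    by apply: shift_none; rewrite !inE !eqxx orbT.
  by apply: subset_leq_card; apply: sub_del.
(* The degenerate pair [{c, c}] lets [shift_none] speak about a single point. *)
have E D : none D c c = del D c.
  by apply/setP => F; apply/noneP/delP => [[]|[]].
have [d ndc] : exists d, c != d.
  by have [->|] := eqVneq c y; [exists x; rewrite eq_sym | exists y].
apply: leq_trans (sH ndc) _; apply: (@leq_trans #|none H c c|).
  by rewrite E; apply: subset_leq_card; apply: sub_del.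
by rewrite -E; apply: shift_none; rewrite !inE orbb eq_sym (negPf ncx).
Qed.

Section Cover.
Variable q : X.
Hypotheses (nqx : q != x) (nqy : q != y) (cG : pair_cover Gs x q).

Let nxq : x != q. Proof. by rewrite eq_sym. Qed.

Let side_x2 : 2 <= #|side Gs x q|.
Proof. by have := good_shift q; rewrite (card_delC _ nxq) (cover_none _ _ _).1 // cards0. Qed.

(** A common point [a] would make [{q, a}] a cover avoiding [x], which a shift to [x] cannot
    create. *)
Lemma side_not_centered a : {in side Gs x q, forall R, a \in R} -> False.
Proof.
move=> aR; have /card_gt0P[R RS] := ltnW side_x2; have [_ xR qR] := sideP _ _ _ _ RS.
have aRR := aR R RS.
apply: (@no_cover_shift q a _ nqx); last exact: cover_side cG aR.
  by apply: contra qR => /eqP ->.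
by apply: contra xR => /eqP <-.
Qed.

(** Only two members of [Gs] miss [x], and at least two miss both [x] and [y], so all members
    missing [x] also miss [y]. A set common to both sides of [H] would leave [y |: R] unmoved,
    against this. *)
Lemma two_side_case : #|side Gs q x| = 2 -> #|H| + loss X k < target X k.
Proof.
move=> Q2; have D2 : #|del Gs x| = 2.
  by rewrite (card_delC _ nqx) noneC (cover_none _ _ _).1 // cards0.
have hN : #|none H x y| <= #|none Gs x y|.
  by apply: shift_none; rewrite !inE !eqxx orbT.
have hD : #|none Gs x y| <= #|del Gs x| by apply: subset_leq_card; apply: sub_del.
have N2 := sH nxy.
have [A0 B0] := sides_nonempty nqx nqy cG.
apply: few_none => //; first by clear -D2 hN hD N2; lia.
move=> _; apply/pred0P => R /=; apply/negP => /andP[/sideP[xRH xR yR] /sideP[yRH _ _]].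
have yG : y |: R \in Gs by rewrite /Gs shift_add // yRH.
have : y |: R \in none Gs x y.
  have /eqP -> : none Gs x y == del Gs x.
    by rewrite eqEcard sub_del D2 (leq_trans N2).
  by apply/delP; rewrite !inE negb_or nxy.
by case/noneP => _ _; rewrite !inE eqxx.
Qed.

End Cover.
End Step.

(** All members of the shifted family missing [x] contain the triple [E]. This caps the members of
    [H] missing both points, while each side of [H] keeps two members, so [cross_ge2] and [both_le2]
    apply to [H] directly. *)
Lemma edge_case H x y q : 2 * 4 < #|X| -> fam 1 H -> cross H H -> spread H -> x != y ->
  q != x -> q != y -> pair_cover (shift x y H) x q ->
  tight (outside x q) (side (shift x y H) q x) (side (shift x y H) x q) ->
  edge_type (side (shift x y H) q x) (side (shift x y H) x q) ->
  #|H| + loss X 1 < target X 1.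
Proof.
move=> nk HV HH sH nxy nqx nqy cG T [e [ce eQ hX]].
have nxq : x != q by rewrite eq_sym.
set Gs := shift x y H in cG T eQ hX.
have GV : fam 1 Gs by apply: shift_sub.
have SX : side Gs x q \subset ksub (outside x q) 3 by apply: side_sub.
have SQ : side Gs q x \subset ksub (outside x q) 3 by rewrite outsideC; apply: side_sub.
have Q2 : 2 <= #|side Gs q x|.
  by have := good_shift sH nxy x; rewrite (card_delC _ nqx) noneC (cover_none _ _ _).1 // cards0.
have eV := edge_sub SQ (ltnW Q2) eQ.
have W7 : 7 <= #|outside x q| by rewrite card_outside //; clear -nk; lia.
have [cQ _] := edge_full SQ SX W7 T ce eV eQ hX.
have [_ fQ] := edge_card SQ ce eV eQ; rewrite cQ in fQ; move/(_ (leqnn _)): fQ => fQ.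
move: (eV); rewrite sub_outside => /andP[xe qe].
pose E := q |: e.
have EG F : F \in Gs -> x \notin F -> E \subset F.
  move=> FG xF; have := cG F FG; rewrite (negPf xF) /= => qF.
  rewrite subUset sub1set qF /=; apply: subset_trans (eQ _ (side_mem qF xF FG)) _.
  exact: subsetDl.
have yE : y \notin E.
  apply/negP => yE; have h : #|none H x y| <= #|none Gs x y|.
    by apply: shift_none; rewrite !inE !eqxx orbT.
  have := leq_trans (sH x y nxy) h; suff /cover_none -> : pair_cover Gs x y by rewrite cards0.
  move=> F FG; have [//|xF] := boolP (x \in F).
  exact: (subsetP (EG F FG xF)).
have xE : x \notin E by rewrite !inE negb_or nxq.
have cE : #|E| = 3 by rewrite cardsU1 qe ce.
have EN : {in none H x y, forall F, E \subset F}.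
  move=> F /noneP[FH xF yF]; apply: EG => //.
  by rewrite /Gs shiftP // (negPf xF) (negPf yF).
have nyx : y != x by rewrite eq_sym.
have Ecp : E \subset outside x y by rewrite sub_outside xE.
have [hN' _] := edge_card (none_sub x y HV) cE Ecp EN.
(* [y |: E] lies in the shifted family although it misses [x]; this requires both it and [x |: E] in
   [H]. *)
have [yEH xEH] : y |: E \in H /\ x |: E \in H.
  apply/andP; rewrite -shift_add //.
  have ycp : y \in outside x q by rewrite !inE negb_or nyx eq_sym.
  have ye : y \notin e by apply: contra yE => ye; rewrite inE ye orbT.
  by have /sideP[] := fQ y ycp ye; rewrite setUCA.
have EA : E \in side H x y by apply/sideP.
have EB : E \in side H y x by apply/sideP.
have qE : q \in E by rewrite !inE eqxx.
(* With [E] alone on a side, [{u', q}] would be a cover: all members missing [u'] contain [E], hence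
   [q]. *)
have big u u' : u != u' -> [set u; u'] = [set x; y] -> E \in side H u u' -> q != u' ->
    2 <= #|side H u u'|.
  move=> nuu Euu Es nqu; have [//|le1] := ltnP 1 #|side H u u'|; exfalso.
  have s1 : #|side H u u'| == 1 by rewrite eqn_leq le1; apply/card_gt0P; exists E.
  have [P EP] := cards1P s1.
  have PE : P = E by move: Es; rewrite EP => /set1P.
  apply: (@spread_not_cover H u' q sH); first by rewrite eq_sym.
  move=> F FH; have [//|uF'] := boolP (u' \in F).
  have [uF|uF] := boolP (u \in F).
    have := side_mem uF uF' FH; rewrite EP PE => /set1P EF.
    by have : q \in F :\ u; [rewrite EF | case/setD1P].
  have FN : F \in none H x y.
    have sub : [set x; y] \subset ~: F by rewrite -Euu subUset !sub1set !inE uF.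
    have /andP[xF yF] : (x \notin F) && (y \notin F).
      by move: sub; rewrite subUset !sub1set !inE.
    by apply/noneP.
  exact: (subsetP (EN F FN)).
have A2 := big x y nxy erefl EA nqy.
have B2 : 2 <= #|side H y x| by apply: big => //; rewrite setUC.
have SA : side H x y \subset ksub (outside x y) 3 by apply: side_sub.
have SB : side H y x \subset ksub (outside x y) 3 by rewrite outsideC; apply: side_sub.
have W6 : 2 * 3 <= #|outside x y| by rewrite card_outside //; clear -nk; lia.
have := cross_ge2 SA SB (side_cross nxy HH) W6 A2 B2.
have := both_le2 HV HH sH nxy.
rewrite (card_four H nxy) targetE // lossE // (card_outside nxy).
rewrite (card_outside nxy) in hN'; set m := #|X| - 2 in hN' *.
have m7 : 7 <= m by rewrite /m; clear -nk; lia.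
(* The at most [m - 3] members missing both points exceed the [m - 5] saved in [both_le2] by 2,
   which the other saving ['C(m - 4, 2)] outweighs. *)
have le : 3 <= m - 4 by clear -m7; lia.
have := leq_bin2l 2 le; rewrite (_ : 'C(3, 2) = 3) // bin1.
by clear -hN' m7; lia.
Qed.

Lemma spread_bound k H : 2 * k.+3 < #|X| -> fam k H -> cross H H -> spread H ->
  #|H| + loss X k < target X k.
Proof.
move=> nk; pose Q A := fam k A -> cross A A -> spread A -> #|A| + loss X k < target X k.
(* The second family of the pair induction is a dummy. *)
apply: (@shift_ind X [set: X] (fun A _ => Q A) _ _ H H) => {H} [A _ sA _|H _ x y _ _ lt IH].
  move=> AV AA spA; have nc : nocover A.
    (* [spread] concerns distinct points only; for [p = q] any second point serves. *)
    move=> p q; have [d [npd]] : exists d, p != d /\ (p != q -> d = q).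
      have [E|npq] := eqVneq p q; last by exists q.
      have : 1 < #|[set: X]| by rewrite cardsT; clear -nk; lia.
      case/card_gt1P=> a [b [_ _ nab]]; have [Ea|na] := eqVneq p a.
        by exists b; split=> //; rewrite Ea.
      by exists a.
    move=> dq; have /ltnW/card_gt0P[F /noneP[FA pF dF]] := spA p d npd; exists F => //.
    by rewrite pF /=; have [<-//|npq] := eqVneq p q; rewrite -dq.
  have := main_stable sA AV AA nc; rewrite cardsT nk => /(_ (ltnW nk)).
  by rewrite /loss /target addn1 addnA.
move=> HV HH sH; have nxy : x != y by apply: contraTN lt => /eqP ->; rewrite ltnn.
set Gs := shift x y H in IH; have cG : #|Gs| = #|H| by apply: card_shift.
have GV : fam k Gs by apply: shift_sub.
have GG : cross Gs Gs by apply: shift_cross.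
have [/forallP sG|nsp] := boolP [forall p, forall q, (p != q) ==> (2 <= #|none Gs p q|)].
  rewrite -cG; apply: IH => // p q npq.
  by have /forallP/(_ q)/implyP := sG p; apply.
have [p [q [npq le]]] : exists p q, p != q /\ #|none Gs p q| <= 1.
  move: nsp; rewrite negb_forall => /existsP[p]; rewrite negb_forall => /existsP[q].
  by rewrite negb_imply -ltnNge => /andP[npq le]; exists p, q.
have gG := good_shift sH nxy; rewrite -/Gs in gG.
have tox p' q' : p' != q' -> pair_cover Gs p' q' -> exists q, [/\ q != x, q != y & pair_cover Gs x q].
  move=> npq' cc; have [] := cover_shift sH npq' cc; rewrite !inE negb_or.
  case/orP=> /eqP E /andP[yp yq]; subst.
    by exists q'; rewrite eq_sym npq' eq_sym yq.
  by exists p'; rewrite npq' eq_sym yp; split=> //; apply: coverC.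
suff : #|Gs| + loss X k < target X k \/ exists q, [/\ q != x, q != y & pair_cover Gs x q].
  rewrite -cG; case=> // -[r [nqx nqy cGq]].
  have nxq : x != r by rewrite eq_sym.
  have nce a : {in side Gs x r, forall R, a \in R} -> False.
    exact: (side_not_centered sH nxy nqx cGq).
  have ncen : ~ centered (side Gs x r) (side Gs r x).
    by case=> a ha; apply: (nce a) => R RS; apply: ha; rewrite inE RS.
  have [|bnd eq] := cover_bound nk GV GG nxq gG cGq; first by case.
  rewrite cG in bnd eq.
  have [E|ne] := eqVneq (#|H| + loss X k) (target X k); last by rewrite cG ltn_neqAle ne.
  have [eqs cs] := eq E; rewrite cG; case: cs => [s2|s2|[k1 sp]].
  (* Equality makes the two sets differ by one exchange, so they share a point and the side would be
     centred. *)
  - have [R1 [R2 [ER nR cU c1 c2]]] := two_side nk GV GG nxq s2 eqs.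
    have : 0 < #|R1 :&: R2|.
      by have := cardsUI R1 R2; rewrite cU c1 c2; clear; lia.
    case/card_gt0P=> a /setIP[a1 a2]; exfalso; apply: (nce a).
    by move=> R; rewrite ER => /set2P[->|->].
  - exact: (two_side_case nk HV HH sH nxy nqx nqy cGq).
  subst k; case: sp => [//|[e [ce eX _]]|ed].
    have [a ae] : exists a, a \in e by apply/card_gt0P; rewrite ce.
    by exfalso; apply: (nce a) => R /eX/subsetP; apply.
  apply: (edge_case nk HV HH sH nxy nqx nqy cGq) => //.
  rewrite /tight -/Gs (addnC #|side Gs r x|) (card_outside nxq) -addnA -lossE //.
have [N0|N1] := posnP #|none Gs p q|.
  by right; apply: (tox p q) => //; apply/cover_none/cards0_eq.
have {}N1 : #|none Gs p q| = 1 by apply/eqP; rewrite eqn_leq le.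
have [lt'|[p' [q' [npq' cc]]]] := one_miss nk GV GG npq gG N1; first by left.
by right; apply: (tox p' q').
Qed.

End NoNearCover.

(** * The extremal families *)

Section Extremal.
Variable X : finType.
Implicit Types (A B D G H : {set {set X}}) (E F P Q R S V W J e : {set X}) (l k m n : nat) (x y v c z : X).
Local Notation n := #|X|.

Lemma card_setC1 x : #|~: [set x]| = n - 1.
Proof. by rewrite cardsCs setCK cards1. Qed.

Lemma sub_setC1 x F : (F \subset ~: [set x]) = (x \notin F).
Proof. by rewrite subsetC sub1set inE. Qed.

Lemma card_hits_eq D W q P : (forall Q, (Q \in D) = (Q \in ksub W q) && (Q :&: P != set0)) ->
  P \subset W -> #|D| + 'C(#|W| - #|P|, q) = 'C(#|W|, q).
Proof.
move=> mD PW; have := cardsD W P; rewrite (setIidPr PW) => <-; apply/eqP; rewrite eqn_leq.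
rewrite card_hits => [||Q]; [|by apply/subsetP=> Q; rewrite mD => /andP[]|by rewrite mD => /andP[]].
rewrite /= card_hits_ge //; apply/subsetP=> Q QW; rewrite inE mD QW /=.
have [QP|//] := eqVneq (Q :&: P) set0.
by have /ksubP[QsW cQ] := QW; apply/ksubP; rewrite subsetD QsW -setI_eq0 QP eqxx.
Qed.

Lemma card_Gfam k i E x0 : #|E| = i.+1 -> i <= k -> x0 \notin E ->
  #|Gfam k.+1 E x0| + 'C(n - 1 - i.+1, k) = 'C(n - 1, k) + 'C(n - 1 - i.+1, k - i).
Proof.
move=> cE ik xE; rewrite (card_del_link _ x0).
have EV : E \subset ~: [set x0] by rewrite sub_setC1.
have -> : del (Gfam k.+1 E x0) x0 = [set F in ksub (~: [set x0]) k.+1 | E \subset F].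
  apply/setP => F; rewrite !inE sub_setC1; case: (x0 \in F); rewrite ?andbF //=.
  by rewrite orbF andbT.
rewrite card_supersets ?cE // card_setC1 subSS.
set L := link _ _; suff mL Q : (Q \in L) = (Q \in ksub (~: [set x0]) k) && (Q :&: E != set0).
  by have := card_hits_eq mL EV; rewrite card_setC1 cE => <-; rewrite -addnA addnC.
rewrite {}/L; rewrite !inE sub_setC1 eqxx /=; case: (boolP (x0 \in Q)) => //= xQ.
rewrite cardsU1 xQ add1n eqSS; congr (_ && _).
have -> : (x0 |: Q) :&: E = Q :&: E.
  by rewrite setIUl (_ : [set x0] :&: E = set0) ?set0U //; apply/eqP; rewrite setI_eq0 disjoints1.
have [EQ|//] := boolP (E \subset _); symmetry.
have /card_gt0P[z zE] : 0 < #|E| by rewrite cE.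
apply/set0Pn; exists z; rewrite inE zE andbT.
by have := subsetP EQ _ zE; case/setU1P => // Ez; rewrite -Ez zE in xE.
Qed.

(** Two members avoid [x0], namely [E] enlarged by either other point of [J]; the link at [x0]
    consists of all sets meeting both of them. The inclusion-exclusion estimate for two hits is
    therefore attained. *)
Lemma card_Jfam k E J x0 : #|E| = k.+2 -> #|J| = 3 -> [disjoint J & E] -> x0 \in J ->
  2 * k.+3 < n -> #|Jfam k.+3 E J x0| + loss X k = target X k.
Proof.
move=> cE cJ dJE x0J nk; have xE : x0 \notin E by have := disjointFr dJE x0J => ->.
have : #|J :\ x0| == 2 by rewrite (cardsD1 x0) x0J add1n in cJ; case: cJ => ->.
case/cards2P=> j1 [j2 [n12 EJ]].
have [/setD1P[n1 J1] /setD1P[n2 J2]] : j1 \in J :\ x0 /\ j2 \in J :\ x0.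
  by rewrite EJ !inE !eqxx orbT.
have [e1 e2] : j1 \notin E /\ j2 \notin E by rewrite !(disjointFr dJE).
have DJ : J = x0 |: [set j1; j2] by rewrite -EJ setD1K.
set V := ~: [set x0]; have cV : #|V| = n - 1 by apply: card_setC1.
have c1 : #|j1 |: E| = k.+3 by rewrite cardsU1 e1 cE.
have c2 : #|j2 |: E| = k.+3 by rewrite cardsU1 e2 cE.
have V1 : j1 |: E \subset V by rewrite sub_setC1 !inE negb_or eq_sym n1.
have V2 : j2 |: E \subset V by rewrite sub_setC1 !inE negb_or eq_sym n2.
have cU : #|(j1 |: E) :|: (j2 |: E)| = k.+4.
  have -> : (j1 |: E) :|: (j2 |: E) = j1 |: (j2 |: E).
    by rewrite setUACA setUid setUA.
  by rewrite cardsU1 !inE negb_or n12 e1 c2.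
have VU : (j1 |: E) :|: (j2 |: E) \subset V by rewrite subUset V1.
rewrite (card_del_link _ x0).
have -> : del (Jfam k.+3 E J x0) x0 = [set j1 |: E; j2 |: E].
  apply/setP => F; apply/delP/set2P => [[]|].
    rewrite inE => /andP[/eqP cF h] xF.
    have {h} : (E \subset F) && (F :&: J != set0).
      case/or3P: h => //; last by rewrite (negPf xF).
      by move/subsetP/(_ _ x0J); rewrite (negPf xF).
    case/andP=> EF /set0Pn[z /setIP[zF zJ]].
    have add j : j \in F -> j \notin E -> F = j |: E.
      move=> jF jE; apply/eqP; rewrite eq_sym eqEcard subUset sub1set jF EF /=.
      by rewrite cF cardsU1 jE cE.
    move: zJ zF; rewrite DJ => /setU1P[->|/set2P[->|->]] zF.
    - by rewrite zF in xF.
    - by left; apply: add.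
    by right; apply: add.
  have mem j : j != x0 -> j \in J -> j \notin E ->
      j |: E \in Jfam k.+3 E J x0 /\ x0 \notin j |: E.
    move=> nj jJ jE; split; last by rewrite !inE negb_or eq_sym nj.
    rewrite inE cardsU1 jE cE eqxx subsetUr /=; apply/orP; left.
    by apply/set0Pn; exists j; rewrite !inE eqxx jJ.
  by case=> ->; apply: mem.
have -> : #|[set j1 |: E; j2 |: E]| = 2.
  rewrite cards2; suff -> : j1 |: E != j2 |: E by [].
  apply/eqP => /setP/(_ j1); rewrite !inE eqxx (negPf e1) (negPf n12) //.
(* A set disjoint from [E] meets both [j1 |: E] and [j2 |: E] exactly when it contains [j1] and
   [j2]. *)
have mL Q : Q \in link (Jfam k.+3 E J x0) x0 =
    (Q \in ksub V k.+2) && ((Q :&: (j1 |: E) != set0) && (Q :&: (j2 |: E) != set0)).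
  rewrite inE [Q \in ksub _ _]inE sub_setC1; case: (boolP (x0 \in Q)) => //= xQ.
  rewrite inE cardsU1 xQ add1n eqSS; congr (_ && _).
  have [h|h] := boolP ((x0 |: Q) :&: E != set0).
    rewrite setU11 !orbT; symmetry; have /set0Pn[z /setIP[zQ zE]] := h.
    have {}zQ : z \in Q by case/setU1P: zQ => // Ez; rewrite -Ez zE in xE.
    by apply/andP; split; apply/set0Pn; exists z; rewrite !inE zQ zE orbT.
  rewrite andbF orbF.
  have QE z : z \in Q -> z \notin E.
    move=> zQ; apply: contra h => zE; apply/set0Pn; exists z; by rewrite !inE zQ zE orbT.
  have hj j : j \notin E -> (Q :&: (j |: E) != set0) = (j \in Q).
    move=> jE; apply/set0Pn/idP => [[z]|jQ]; last by exists j; rewrite !inE jQ eqxx.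
    rewrite !inE => /andP[zQ /orP[/eqP <- //|zE]]; by rewrite (negPf (QE z zQ)) in zE.
  rewrite !hj // DJ subUset sub1set setU11 subUset !sub1set !inE (negPf n1) (negPf n2) /=.
  suff -> : E \subset x0 |: Q = false by [].
  apply/negP => EQ; have /card_gt0P[z zE] : 0 < #|E| by rewrite cE.
  case/negP: h; apply/set0Pn; exists z; by rewrite inE zE (subsetP EQ).
set L := link _ _ in mL *; pose U := ksub (V :\: (j1 |: E)) k.+2 :|: ksub (V :\: (j2 |: E)) k.+2.
have disj : [disjoint L & U].
  apply/pred0P => Q /=; rewrite mL; apply/negP => /andP[/and3P[_ h1 h2]].
  by case/setUP=> /ksubP[]; rewrite subsetD -setI_eq0 ?(negPf h1) ?(negPf h2) andbF.
have LU : L :|: U = ksub V k.+2.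
  apply/setP => Q; rewrite in_setU mL in_setU; apply/orP/idP => [[/andP[]//|]|QV].
    by case/orP; apply: (subsetP (ksubS _ (subsetDl _ _))).
  have [QsV cQ] := ksubP _ _ _ QV; rewrite QV /=.
  have [h1|h1] := boolP (Q :&: (j1 |: E) != set0); last first.
    right; apply/orP; left; apply/ksubP; rewrite subsetD QsV -setI_eq0; split=> //.
    by rewrite negbK in h1.
  have [h2|h2] := boolP (Q :&: (j2 |: E) != set0); first by left.
  right; apply/orP; right; apply/ksubP; rewrite subsetD QsV -setI_eq0; split=> //.
  by rewrite negbK in h2.
have := cardsU_disj disj; rewrite LU card_ksub cV.
have := card_avoid2 V k.+2 (j1 |: E) (j2 |: E); rewrite -/U.
rewrite !cardsD (setIidPr V1) (setIidPr V2) (setIidPr VU) c1 c2 cU cV /loss /target.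
have -> : n - 1 - k.+3 = n - k.+3 - 1 by clear; lia.
have -> : n - 1 - k.+4 = n - k.+3 - 2 by clear; lia.
rewrite (@bin_pred (n - k.+3 - 1)); last by clear -nk; lia.
have -> : n - k.+3 - 1 - 1 = n - k.+3 - 2 by clear; lia.
move=> h1 h2; clear -h1 h2; lia.
Qed.

Lemma subS_card H G : subS H G -> #|H| <= #|G|.
Proof.
case=> f [fi fH]; rewrite -(card_imset H (imset_inj fi)); apply: subset_leq_card.
by apply/subsetP=> _ /imsetP[E EH ->]; apply: fH.
Qed.

Lemma subset_subS H G : H \subset G -> subS H G.
Proof.
by move=> /subsetP HG; exists id; split=> // E EH; rewrite imset_id; apply: HG.
Qed.

Lemma iso_card H G : isomorphic H G -> #|H| = #|G|.
Proof. by case=> /subS_card h1 /subS_card h2; apply/eqP; rewrite eqn_leq h1. Qed.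

Lemma iso_of_sub H G : H \subset G -> #|G| <= #|H| -> isomorphic H G.
Proof.
move=> HG le; have /eqP -> : H == G by rewrite eqEcard HG.
by split; apply: subset_subS.
Qed.

Lemma good_of k H : fam k H -> cross H H -> ~ subS_F0 k.+3 H -> ~ subS_F1 k.+3 H -> good H.
Proof.
move=> /subsetP HV HH n0 n1 c; rewrite ltnNge; apply/negP => le.
have [d0|d1] := posnP #|del H c|.
  apply: n0; exists c; apply: subset_subS; apply/subsetP=> F FH.
  have := HV F FH; rewrite ksubT inE => -> /=; apply/negPn/negP => cF.
  by have : F \in del H c; [apply/delP | rewrite (cards0_eq d0) in_set0].
have /cards1P[F EF] : #|del H c| == 1 by rewrite eqn_leq le.
have /delP[FH cF] : F \in del H c by rewrite EF set11.
apply: n1; exists F, c; have := HV F FH; rewrite ksubT => /eqP cardF; split=> //; split=> //.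
apply: subset_subS; apply/subsetP=> Q QH; rewrite !inE.
have [//|nQ] := eqVneq Q F; have := HV Q QH; rewrite ksubT => -> /=.
rewrite HH // andbT; apply/negPn/negP => cQ.
have : Q \in del H c by apply/delP.
by rewrite EF inE (negPf nQ).
Qed.

Lemma centered_sub k H x y a : x != y -> fam k H -> pair_cover H x y -> 0 < #|side H x y| ->
  {in side H x y :|: side H y x, forall R, a \in R} ->
  a \notin [set x; y] /\ H \subset Gfam k.+3 [set x; y] a.
Proof.
move=> nxy /subsetP HV cH A0 ha; split.
  have /card_gt0P[R RA] := A0; have [_ xR yR] := sideP _ _ _ _ RA.
  have aR : a \in R by apply: ha; rewrite inE RA.
  by rewrite !inE negb_or; apply/andP; split; [apply: contra xR|apply: contra yR] => /eqP <-.
apply/subsetP=> F FH; have := HV F FH; rewrite ksubT inE => -> /=.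
rewrite subUset !sub1set; have [xF|xF] := boolP (x \in F); have [yF|yF] := boolP (y \in F) => //=.
- have : a \in F :\ x by apply: ha; rewrite inE (side_mem xF yF FH).
  by move=> /setD1P[_ ->] /=; apply/set0Pn; exists x; rewrite !inE xF eqxx.
- have : a \in F :\ y by apply: ha; rewrite inE (side_mem yF xF FH) orbT.
  by move=> /setD1P[_ ->] /=; apply/set0Pn; exists y; rewrite !inE yF eqxx orbT.
by have := cH F FH; rewrite (negPf xF) (negPf yF).
Qed.

Lemma edge_sub_Gfam k H x y e : x != y -> fam k H -> pair_cover H x y -> 0 < #|side H x y| ->
  #|e| = 2 -> {in side H x y, forall R, e \subset R} -> hits (side H y x) e ->
  [/\ #|x |: e| = 3, y \notin x |: e & H \subset Gfam k.+3 (x |: e) y].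
Proof.
move=> nxy /subsetP HV cH A0 ce he hB.
have /card_gt0P[R RA] := A0; have [_ xR yR] := sideP _ _ _ _ RA.
have xe : x \notin e by apply: contra xR; apply: (subsetP (he R RA)).
have ye : y \notin e by apply: contra yR; apply: (subsetP (he R RA)).
split; first by rewrite cardsU1 xe ce.
  by rewrite !inE negb_or eq_sym nxy.
apply/subsetP=> F FH; have := HV F FH; rewrite ksubT inE => -> /=.
have [yF|yF] := boolP (y \in F) => /=.
  apply/orP; right; have [xF|xF] := boolP (x \in F).
    by apply/set0Pn; exists x; rewrite !inE xF eqxx.
  have /set0Pn[z] := hB _ (side_mem yF xF FH); rewrite !inE => /andP[/andP[_ zF] ze].
  by apply/set0Pn; exists z; rewrite !inE zF ze orbT.
have := cH F FH; rewrite (negPf yF) orbF => xF; rewrite orbF subUset sub1set xF.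
exact: subset_trans (he _ (side_mem xF yF FH)) (subsetDl _ _).
Qed.

Lemma pair_sub_Jfam k H x y : 2 * k.+3 < n -> x != y -> fam k H -> cross H H -> pair_cover H x y ->
  #|side H x y| = 2 -> #|side H x y| + #|side H y x| + loss X k = 'C(n - 2, k.+2) + 2 ->
  exists E J x0, [/\ #|E| = k.+2, #|J| = 3, [disjoint J & E], x0 \in J & H \subset Jfam k.+3 E J x0].
Proof.
move=> nk nxy HV HH cH A2 eq.
have [R1 [R2 [ES n12 cU c1 c2]]] := two_side nk HV HH nxy A2 eq.
have K1 : R1 \in side H x y by rewrite ES !inE eqxx.
have K2 : R2 \in side H x y by rewrite ES !inE eqxx orbT.
have [_ x1 y1] := sideP _ _ _ _ K1; have [_ x2 y2] := sideP _ _ _ _ K2.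
have cI : #|R1 :&: R2| = k.+1 by have := cardsUI R1 R2; rewrite cU c1 c2; clear; lia.
have /cards1P[a Ea] : #|R1 :\: R2| == 1 by rewrite cardsD cI c1; apply/eqP; clear; lia.
have /cards1P[b Eb] : #|R2 :\: R1| == 1 by rewrite cardsD setIC cI c2; apply/eqP; clear; lia.
have /setDP[a1 a2] : a \in R1 :\: R2 by rewrite Ea set11.
have /setDP[b2 b1] : b \in R2 :\: R1 by rewrite Eb set11.
have nya : y != a by apply: contra y1 => /eqP ->.
have nyb : y != b by apply: contra y2 => /eqP ->.
have nxa : x != a by apply: contra x1 => /eqP ->.
have nxb : x != b by apply: contra x2 => /eqP ->.
have nab : a != b by apply: contra a2 => /eqP ->.
(* [R1] and [R2] differ by exchanging [a] and [b]. The common part with [x] forms the core, and a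
   member through [y] but not [x] that misses the common part must contain both [a] and [b]. *)
exists (x |: (R1 :&: R2)), (y |: [set a; b]), y; split.
- by rewrite cardsU1 inE (negPf x1) cI.
- by rewrite cardsU1 !inE negb_or nya nyb cards2 nab.
- rewrite disjoints_subset !subUset !sub1set !inE !negb_or eq_sym nxy (negPf y1) /=.
  by rewrite ![_ == x]eq_sym nxa nxb (negPf a2) (negPf b1) andbF.
- by rewrite !inE eqxx.
apply/subsetP=> F FH; have := subsetP HV F FH; rewrite ksubT inE => -> /=.
have [yF|yF] := boolP (y \in F) => /=.
  have [xF|xF] := boolP (x \in F).
    apply/or3P/Or33/set0Pn; by exists x; rewrite !inE xF eqxx.
  have FB := side_mem yF xF FH; have AB := side_cross nxy HH.
  have [z z1] := cross_mem AB K1 FB; rewrite !inE => /andP[_ zF].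
  have [w w2] := cross_mem AB K2 FB; rewrite !inE => /andP[_ wF].
  have [z2|z2] := boolP (z \in R2).
    by apply/or3P/Or33/set0Pn; exists z; rewrite !inE zF z1 z2 orbT.
  have [w1|w1] := boolP (w \in R1).
    by apply/or3P/Or33/set0Pn; exists w; rewrite !inE wF w1 w2 orbT.
  have : z \in R1 :\: R2 by rewrite inE z2.
  rewrite Ea => /set1P Ez; have : w \in R2 :\: R1 by rewrite inE w1.
  by rewrite Eb => /set1P Ew; apply/or3P/Or32; rewrite !subUset !sub1set yF -Ez -Ew zF wF.
have := cH F FH; rewrite (negPf yF) orbF => xF.
have FA := side_mem xF yF FH; apply/or3P/Or31.
have sF : R1 :&: R2 \subset F :\ x.
  by move: FA; rewrite ES => /set2P[->|->]; [apply: subsetIl|apply: subsetIr].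
rewrite subUset sub1set xF (subset_trans sF (subsetDl _ _)) /=.
have [z zJ] : exists2 z, z \in F :\ x & z \in [set a; b].
  by move: FA; rewrite ES => /set2P[->|->]; [exists a|exists b]; rewrite // !inE eqxx ?orbT.
move: zJ => /setD1P[_ zF] zJ; apply/set0Pn; exists z; by rewrite inE zF inE zJ orbT.
Qed.

End Extremal.

(** A numerical coincidence of rank 4: the general count of [Gfam] agrees with the extremal value
    for [E] of size 2 and of size 3. *)
Lemma card_Gfam4 (X : finType) (i : nat) (E : {set X}) (x0 : X) :
  8 < #|X| -> #|E| = i.+2 -> i <= 1 -> x0 \notin E ->
  #|Gfam 4 E x0| + loss X 1 = target X 1.
Proof.
move=> n8 cE i1 xE; have := card_Gfam (k := 3) cE (leq_trans i1 (isT : 1 <= 2)) xE.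
rewrite /loss /target; set g := #|_|; move: n8; move: #|X| g => n g n8; clear - n8 i1.
have h3 a : 0 < a -> 'C(a, 3) = 'C(a - 1, 3) + 'C(a - 1, 2) by apply: bin_pred.
have h2 a : 0 < a -> 'C(a, 2) = 'C(a - 1, 2) + (a - 1).
  by move=> a0; rewrite bin_pred // bin1.
have -> : n - 4 - 1 = n - 5 by lia.
have -> : n - 4 - 2 = n - 6 by lia.
have e4 : 'C(n - 4, 3) = 'C(n - 5, 3) + 'C(n - 5, 2) by rewrite h3 -?subnDA //; lia.
have e5 : 'C(n - 5, 2) = 'C(n - 6, 2) + (n - 6) by rewrite h2 -?subnDA //; lia.
case: i i1 => [|[|//]] _.
  have -> : n - 1 - 2 = n - 3 by lia.
  have -> : 'C(n - 3, 3) = 'C(n - 4, 3) + 'C(n - 4, 2) by rewrite h3 -?subnDA //; lia.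
  have -> : 'C(n - 3, 3 - 1) = 'C(n - 4, 2) + (n - 4) by rewrite (h2 (n - 3)) -?subnDA //; lia.
  lia.
have -> : n - 1 - 3 = n - 4 by lia.
rewrite subSS subSS subn0 bin1; lia.
Qed.

Lemma fam_uniform (X : finType) (k : nat) (H : {set {set X}}) : uniform k.+3 H -> fam k H.
Proof. by move=> uH; apply/subsetP=> F /uH cF; rewrite ksubT cF. Qed.

(** * Equality cases and assembly of the theorem *)

Section Equality.
Variables (X : finType) (k : nat) (H : {set {set X}}).
Hypotheses (nk : 2 * k.+3 < #|X|) (HV : fam k H) (HH : cross H H) (gH : good H).
Hypothesis nG2 : k = 0 -> ~ subS_G 3 2 H.

Let side_gt0 x y : x != y -> pair_cover H x y -> 0 < #|side H x y|.
Proof.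
move=> nxy /cover_none N0; have := gH y.
by rewrite (card_delC _ nxy) N0 cards0; apply: ltnW.
Qed.

Lemma not_centered x y : x != y -> pair_cover H x y ->
  ~ (k = 0 /\ centered (side H x y) (side H y x)).
Proof.
move=> nxy cH [k0 [a ha]].
have [aE sub] := centered_sub nxy HV cH (side_gt0 nxy cH) ha.
apply: (nG2 k0); exists [set x; y], a; rewrite cards2 nxy; split=> //; split=> //.
by apply: subset_subS; rewrite k0 in sub.
Qed.

Lemma equality_J x y : x != y -> pair_cover H x y -> #|side H x y| = 2 ->
  #|side H x y| + #|side H y x| + loss X k = 'C(#|X| - 2, k.+2) + 2 ->
  #|H| + loss X k = target X k -> iso_J k.+3 2 H.
Proof.
move=> nxy cH s2 eqs eq.
have [E [J [x0 [cE cJ dJE xJ sub]]]] := pair_sub_Jfam nk nxy HV HH cH s2 eqs.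
exists E, J, x0; split=> //; apply: iso_of_sub => //.
by rewrite -(leq_add2r (loss X k)) eq card_Jfam.
Qed.

Lemma equality_structure x y : x != y -> pair_cover H x y -> #|H| + loss X k = target X k ->
  if k.+3 == 4 then [\/ iso_J k.+3 2 H, iso_G k.+3 2 H | iso_G k.+3 3 H] else iso_J k.+3 2 H.
Proof.
move=> nxy cH eq; have nyx : y != x by rewrite eq_sym.
have [_ /(_ eq)[eqs cs]] := cover_bound nk HV HH nxy gH cH (not_centered nxy cH).
have J : iso_J k.+3 2 H -> if k.+3 == 4 then [\/ iso_J k.+3 2 H, iso_G k.+3 2 H | iso_G k.+3 3 H]
    else iso_J k.+3 2 H by move=> h; case: ifP => // _; constructor 1.
case: cs => [s2|s2|[k1 sp]].
- exact: J (equality_J nxy cH s2 eqs eq).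
- by rewrite (addnC #|side H x y|) in eqs; apply/J/(equality_J nyx (coverC cH) s2 eqs eq).
subst k; rewrite eqxx.
have isoG i (E : {set X}) x0 : #|E| = i.+2 -> i <= 1 -> x0 \notin E -> H \subset Gfam 4 E x0 -> iso_G 4 i.+2 H.
  move=> cE i1 xE sub; exists E, x0; split=> //; split=> //; apply: iso_of_sub => //.
  by rewrite -(leq_add2r (loss X 1)) eq (card_Gfam4 nk cE i1 xE).
case: sp => [[a ha]|[e [ce he hB]]|[e [ce he hB]]].
- have [aE sub] := centered_sub nxy HV cH (side_gt0 nxy cH) ha.
  by constructor 2; apply: isoG aE sub => //; rewrite cards2 nxy.
- have [cE yE sub] := edge_sub_Gfam nxy HV cH (side_gt0 nxy cH) ce he hB.
  by constructor 3; apply: isoG cE _ yE sub.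
- have cH' := coverC cH.
  have [cE yE sub] := edge_sub_Gfam nyx HV cH' (side_gt0 nyx cH') ce he hB.
  by constructor 3; apply: isoG cE _ yE sub.
Qed.

Lemma main_dichotomy : #|H| + loss X k < target X k \/ exists x y : X, x != y /\ pair_cover H x y.
Proof.
have [/existsP[x /existsP[y /andP[nxy le]]]|sp] :=
  boolP [exists x, exists y, (x != y) && (#|none H x y| <= 1)]; last first.
  left; apply: spread_bound => // p q npq; rewrite ltnNge; apply: contra sp => le.
  by apply/existsP; exists p; apply/existsP; exists q; rewrite npq.
have [N0|N1] := posnP #|none H x y|.
  by right; exists x, y; split=> //; apply/cover_none/cards0_eq.
by apply: (one_miss nk HV HH nxy gH); apply/eqP; rewrite eqn_leq le.
Qed.

End Equality.

Theorem theorem1p6 (k n : nat) (X : finType) (H : {set {set X}}) :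
  3 <= k -> 2 * k < n -> #|X| = n ->
  uniform k H -> intersecting H ->
  ~ subS_F0 k H -> ~ subS_F1 k H -> (k = 3 -> ~ subS_G k 2 H) ->
  #|H| + 'C(n - k - 1, k - 1) + 'C(n - k - 2, k - 2) <= 'C(n - 1, k - 1) + 2
  /\ (#|H| + 'C(n - k - 1, k - 1) + 'C(n - k - 2, k - 2) = 'C(n - 1, k - 1) + 2
      <-> (if k == 4 then [\/ iso_J k 2 H, iso_G k 2 H | iso_G k 3 H]
           else iso_J k 2 H)).
Proof.
case: k => [|[|[|k]]] // _ nk cX uH HH n0 n1 nG2; subst n.
(* With the rank written [k.+3], the binomials of the statement are convertible to [loss] and
   [target]. *)
rewrite -addnA -[X in _ + X]/(loss X k) -[X in _ <= X]/(target X k) -[X in _ = X <-> _]/(target X k).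
have HV := fam_uniform uH; have gH := good_of HV HH n0 n1.
have nG : k = 0 -> ~ subS_G 3 2 H by move=> k0; subst k; apply: nG2.
have isoJ : iso_J k.+3 2 H -> #|H| + loss X k = target X k.
  by case=> [E [J [x0 [cE cJ dJE xJ /iso_card ->]]]]; apply: card_Jfam.
have isoG i : k.+3 = 4 -> i <= 1 -> iso_G k.+3 i.+2 H -> #|H| + loss X k = target X k.
  case=> k1 i1 [E [x0 [cE [xE /iso_card ->]]]]; subst k; exact: card_Gfam4 cE i1 xE.
have iso_eq : (if k.+3 == 4 then [\/ iso_J k.+3 2 H, iso_G k.+3 2 H | iso_G k.+3 3 H]
    else iso_J k.+3 2 H) -> #|H| + loss X k = target X k.
  by case: eqP => [k4 [|/isoG->//|/isoG->//]|_]; apply: isoJ.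
case: (main_dichotomy nk HV HH gH) => [lt|[x [y [nxy cH]]]].
  split; first exact: ltnW.
  by split=> [E|/iso_eq //]; rewrite E ltnn in lt.
split; last by split=> [|//]; apply: (equality_structure nk HV HH gH nG nxy cH).
by have [] := cover_bound nk HV HH nxy gH cH (not_centered HV gH nG nxy cH).
Qed.
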